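(* Let $f$ be the generator of a hyperbolic continuous one-parameter semigroup of holomorphic self-mappings of the open unit disk $\mathbb{D}$ with the Denjoy-Wolff point $a=1$, i.e. $f(1)=0$ and $m:=f'(1)>0$. Suppose there are pairwise distinct boundary regular null points $\zeta_1,\dots,\zeta_N\in\partial\mathbb{D}$ of $f$ different from $a$, with $m_n:=f'(\zeta_n)<0$. Then $$\Big|\frac1{f(z)}-\sum_{n=1}^N\frac1{|f'(\zeta_n)|}\Big(\frac1{z-1}-\frac1{z-\zeta_n}\Big)+\frac{\Delta}{1-|z|^2}\,\frac{1-\bar z}{1-z}\Big|\le\frac{\Delta}{1-|z|^2}$$ for all $z\in\mathbb{D}$, where $$\Delta=\frac1m-\sum_{n=1}^N\frac1{|m_n|}.$$
   Context: $\mathbb{D}$ is the open unit disk in $\mathbb{C}$. A (continuous one-parameter) semigroup on $\mathbb{D}$ is a family $\{F_t\}_{t\ge0}$ of holomorphic self-mappings of $\mathbb{D}$ with $F_{s+t}=F_s\circ F_t$, $F_0(z)=z$, continuous in $t$. Its (infinitesimal) generator is the holomorphic function $f(z)=\lim_{t\to0^+}\frac1t(z-F_t(z))$ on $\mathbb{D}$. For a semigroup that is nontrivial and contains no elliptic automorphisms of $\mathbb{D}$, the Denjoy-Wolff point is the unique $a\in\overline{\mathbb{D}}$ with $F_t(z)\to a$ as $t\to\infty$ for all $z\in\mathbb{D}$. For $\zeta\in\partial\mathbb{D}$, $f(\zeta)$ denotes the angular (nontangential) limit of $f$ at $\zeta$, and, when this is $0$, $f'(\zeta)=\angle\lim_{z\to\zeta}\frac{f(z)}{z-\zeta}$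 is the angular derivative. A boundary regular null point of $f$ is a point $\zeta\in\partial\mathbb{D}$ at which the angular limit of $f$ exists and equals $0$ and the angular derivative exists and is finite. The semigroup is hyperbolic if its Denjoy-Wolff point $a$ lies on $\partial\mathbb{D}$ and $f'(a)>0$. *)

(* Defs.v *)
From Stdlib Require Import Reals.
From Coquelicot Require Import Coquelicot.
Local Open Scope R_scope.

(** Functions on the disk are represented by total functions [C -> C]; only
    their values on the disk are ever constrained or used. *)
Definition unit_disk (z : C) : Prop := Cmod z < 1.

Definition holomorphic_on_disk (g : C -> C) : Prop :=
  forall z : C, unit_disk z -> ex_derive (K := C_AbsRing) (V := C_NormedModule) g z.

Definition holomorphic_self_map (g : C -> C) : Prop :=
  holomorphic_on_disk g /\ (forall z : C, unit_disk z -> unit_disk (g z)).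

Definition disk_automorphism (g : C -> C) : Prop :=
  holomorphic_self_map g /\
  exists h : C -> C, holomorphic_self_map h /\
    forall z : C, unit_disk z -> h (g z) = z /\ g (h z) = z.

(** The identity is not counted as elliptic: it belongs to every semigroup. *)
Definition elliptic_automorphism (g : C -> C) : Prop :=
  disk_automorphism g /\
  (exists z : C, unit_disk z /\ g z = z) /\
  (exists z : C, unit_disk z /\ g z <> z).

Definition semigroup (F : R -> C -> C) : Prop :=
  (forall t : R, 0 <= t -> holomorphic_self_map (F t)) /\
  (forall s t : R, 0 <= s -> 0 <= t ->
     forall z : C, unit_disk z -> F (s + t) z = F s (F t z)) /\
  (forall z : C, unit_disk z -> F 0 z = z) /\
  (forall z : C, unit_disk z ->
     continuous_on (fun t : R => 0 <= t) (fun t : R => F t z)).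

Definition is_generator (F : R -> C -> C) (f : C -> C) : Prop :=
  holomorphic_on_disk f /\
  forall z : C, unit_disk z ->
    filterlim (fun t : R => (RtoC (/ t) * (z - F t z))%C)
      (at_right 0) (locally (f z)).

Definition is_denjoy_wolff_point (F : R -> C -> C) (a : C) : Prop :=
  (exists t : R, 0 <= t /\ exists z : C, unit_disk z /\ F t z <> z) /\
  (forall t : R, 0 <= t -> ~ elliptic_automorphism (F t)) /\
  Cmod a <= 1 /\
  (forall z : C, unit_disk z ->
     filterlim (fun t : R => F t z) (Rbar_locally p_infty) (locally a)).

(** Nontangential approach region at the boundary point [zeta], of aperture [M];
    it is contained in the disk. *)
Definition stolz_region (zeta : C) (M : R) (z : C) : Prop :=
  Cmod (z - zeta) < M * (1 - Cmod z).

Definition angular_limit (g : C -> C) (zeta l : C) : Prop :=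
  forall M : R, 1 < M ->
    filterlim g (within (stolz_region zeta M) (locally zeta)) (locally l).

Definition is_angular_derivative (f : C -> C) (zeta l : C) : Prop :=
  angular_limit f zeta 0%R /\
  angular_limit (fun z : C => (f z / (z - zeta))%C) zeta l.

Definition boundary_regular_null_point (f : C -> C) (zeta : C) : Prop :=
  Cmod zeta = 1 /\ exists l : C, is_angular_derivative f zeta l.

Definition hyperbolic_semigroup (F : R -> C -> C) : Prop :=
  semigroup F /\
  exists (f : C -> C) (a : C) (m : R),
    is_generator F f /\ is_denjoy_wolff_point F a /\ Cmod a = 1 /\
    is_angular_derivative f a m /\ 0 < m.

(* Main.v *)
Require Import Defs.
From Stdlib Require Import Reals Lra Lia.
From Coquelicot Require Import Coquelicot.
Local Open Scope R_scope.

(** Wolff's horodisk inequality at the Denjoy-Wolff point [1] says that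
    [q z = - (1 - z)^2 / f z] has nonnegative real part.  A null point [zeta n] gives [q]
    a simple pole in the Julia sense, i.e. a point mass of the Herglotz measure, and
    [(1 - zeta n) (1 - z) / (z - zeta n)] is the Herglotz transform of a point mass at
    [zeta n].  Removing all these masses leaves a function [G] with nonnegative real part
    and [G r / (1 - r) -> Delta] as [r -> 1], for which Julia's lemma reads
    [|G z|^2 (1 - |z|^2) <= 2 Delta Re (G z) |1 - z|^2]; this is the claimed disk estimate
    for [- G z / (1 - z)^2].  Both boundary statements come from the two-point
    Schwarz-Pick inequality by moving one of the points radially to the boundary. *)

(** * Goursat's lemma for real closed forms *)

(** Masses are removed one at a time, so Julia's inequality for a single mass suffices: the
    transform taken off at one null point stays bounded near the others, which are distinct from it,
    and so leaves their masses unchanged. Each transform vanishes at [1] with slope [1] in [1 - r],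
    so each removal lowers the slope at [1], initially [1 / m], by exactly [1 / |m_n|]; this
    produces [Delta]. The function left over may be identically [0] (when [Delta = 0]), which is why
    the two-point inequality is wanted for [Re G >= 0] and not only for [Re G > 0]. The two-point
    inequality rests on Schwarz's lemma, reached without a maximum principle: constancy of circle
    means of [phi z / z] bounds the derivative at [0], Mobius maps carry this bound to every point,
    and integration along a radius gives the inequality for values. Holomorphy means here bare
    complex differentiability, with no continuity of the derivative, hence Goursat's subdivision. *)

Definition rect_circulation (P Q : R -> R -> R) (a b c d : R) : R :=
  RInt (fun x => P x c) a b - RInt (fun x => P x d) a b
  + RInt (fun y => Q b y) c d - RInt (fun y => Q a y) c d.

(** The shared [q] is both dP/dy and dQ/dx. Differentiability is total, as the chain rule requires,
    but continuity of the partials is not asked, so Green's formula is not at hand. *)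
Definition closed_form_at (P Q : R -> R -> R) (x y : R) : Prop :=
  exists px q qy : R,
    differentiable_pt_lim P x y px q /\ differentiable_pt_lim Q x y q qy.

Lemma differentiable_pt_lim_swap (f : R -> R -> R) (x y lx ly : R) :
  differentiable_pt_lim f x y lx ly ->
  differentiable_pt_lim (fun u v => f v u) y x ly lx.
Proof.
intros H eps.
destruct (H eps) as [d Hd]. exists d. intros u v Hu Hv.
specialize (Hd v u Hv Hu).
rewrite Rmax_comm.
replace (ly * (u - y) + lx * (v - x)) with (lx * (v - x) + ly * (u - y)) by ring.
exact Hd.
Qed.

Lemma differentiable_pt_lim_continuous_fst (f : R -> R -> R) (x y lx ly : R) :
  differentiable_pt_lim f x y lx ly -> continuous (fun s => f s y) x.
Proof.
intros H. apply (ex_derive_continuous (K := R_AbsRing) (V := R_NormedModule) (fun s => f s y) x). exists (lx * 1 + ly * 0).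
apply is_derive_Reals.
apply (derivable_pt_lim_comp_2d f (fun s => s) (fun _ => y) x).
- exact H.
- apply derivable_pt_lim_id.
- apply derivable_pt_lim_const.
Qed.

Lemma differentiable_pt_lim_continuous_snd (f : R -> R -> R) (x y lx ly : R) :
  differentiable_pt_lim f x y lx ly -> continuous (fun s => f x s) y.
Proof.
intros H. apply differentiable_pt_lim_swap in H.
exact (differentiable_pt_lim_continuous_fst _ _ _ _ _ H).
Qed.

Definition closed_form_on (P Q : R -> R -> R) (a b c d : R) : Prop :=
  forall x y, a <= x <= b -> c <= y <= d -> closed_form_at P Q x y.

Lemma closed_form_ex_RInt (P Q : R -> R -> R) (a b c d a' b' c' d' y x : R) :
  closed_form_on P Q a b c d ->
  a <= a' <= b -> a <= b' <= b -> c <= c' <= d -> c <= d' <= d ->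
  c <= y <= d -> a <= x <= b ->
  ex_RInt (fun s => P s y) a' b' /\ ex_RInt (fun s => Q x s) c' d'.
Proof.
intros H Ha Hb Hc Hd Hy Hx. split; apply (ex_RInt_continuous (V := R_CompleteNormedModule)); intros z Hz.
- assert (a <= z <= b) by (revert Hz; unfold Rmin, Rmax; destruct (Rle_dec a' b'); lra).
  destruct (H z y) as (px & q & qy & HP & _); auto.
  exact (differentiable_pt_lim_continuous_fst _ _ _ _ _ HP).
- assert (c <= z <= d) by (revert Hz; unfold Rmin, Rmax; destruct (Rle_dec c' d'); lra).
  destruct (H x z) as (px & q & qy & _ & HQ); auto.
  exact (differentiable_pt_lim_continuous_snd _ _ _ _ _ HQ).
Qed.

Lemma rect_circulation_quarter (P Q : R -> R -> R) (a m b c n d : R) :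
  closed_form_on P Q a b c d -> a <= m <= b -> c <= n <= d ->
  rect_circulation P Q a b c d =
  rect_circulation P Q a m c n + rect_circulation P Q m b c n
  + rect_circulation P Q a m n d + rect_circulation P Q m b n d.
Proof.
intros H Hm Hn. unfold rect_circulation.
assert (HP : forall y, c <= y <= d ->
  RInt (fun x => P x y) a b = RInt (fun x => P x y) a m + RInt (fun x => P x y) m b).
{ intros y Hy. symmetry. apply (RInt_Chasles (V := R_CompleteNormedModule) (fun x => P x y));
  eapply closed_form_ex_RInt with (c' := c) (d' := d) (x := a); eauto; lra. }
assert (HQ : forall x, a <= x <= b ->
  RInt (fun y => Q x y) c d = RInt (fun y => Q x y) c n + RInt (fun y => Q x y) n d).
{ intros x Hx. symmetry. apply (RInt_Chasles (V := R_CompleteNormedModule) (fun y => Q x y));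
  eapply closed_form_ex_RInt with (a' := a) (b' := b) (y := c); eauto; lra. }
rewrite !HP, !HQ by lra. ring.
Qed.

Lemma RInt_near_const (f : R -> R) (a b k M : R) :
  a <= b -> ex_RInt f a b -> (forall t, a <= t <= b -> Rabs (f t - k) <= M) ->
  Rabs (RInt f a b - k * (b - a)) <= M * (b - a).
Proof.
intros Hab Hf HM.
replace (RInt f a b - k * (b - a)) with (RInt (fun t => f t - k) a b).
- rewrite (Rmult_comm M). apply abs_RInt_le_const; auto.
  apply (ex_RInt_minus (V := R_CompleteNormedModule) f (fun _ => k)); auto. apply ex_RInt_const.
- rewrite (RInt_minus (V := R_CompleteNormedModule) f (fun _ => k)); auto.
  + rewrite RInt_const. unfold minus, plus, opp, scal; simpl. unfold mult; simpl. ring.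
  + apply ex_RInt_const.
Qed.

(** Differences between opposite sides are, to first order, [- q (d - c)] for [P] and [q (b - a)]
    for [Q]; once integrated they cancel because [q] is shared. The remainders are at most [eps]
    times the half-perimeter, over sides whose lengths add up to the half-perimeter. *)
Lemma rect_circulation_local (P Q : R -> R -> R) (x y eps : R) :
  closed_form_at P Q x y -> 0 < eps ->
  exists delta, 0 < delta /\ forall a b c d,
    a <= x <= b -> c <= y <= d -> b - a < delta -> d - c < delta ->
    closed_form_on P Q a b c d ->
    Rabs (rect_circulation P Q a b c d) <= eps * (b - a + (d - c)) ^ 2.
Proof.
intros (px & q & qy & HP & HQ) He.
(* Each side difference compares two values with the tangent map, so [eps / 2] apiece adds up to
   [eps]. *)
assert (He2 : 0 < eps / 2) by lra.
destruct (HP (mkposreal _ He2)) as [d1 H1]. destruct (HQ (mkposreal _ He2)) as [d2 H2]; simpl in H1, H2.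
exists (Rmin d1 d2). split. { apply Rmin_pos; apply cond_pos. }
intros a b c d Hx Hy Hba Hdc Hcl.
pose proof (Rmin_l d1 d2). pose proof (Rmin_r d1 d2).
set (S := b - a + (d - c)). assert (HS : 0 <= S) by (unfold S; lra).
assert (Hmax : forall s t, a <= s <= b -> c <= t <= d -> Rmax (Rabs (s - x)) (Rabs (t - y)) <= S).
{ intros s t Hs Ht. unfold S. apply Rmax_lub; apply Rabs_le; lra. }
assert (E1 : forall s t, a <= s <= b -> c <= t <= d ->
  Rabs (P s t - P x y - (px * (s - x) + q * (t - y))) <= eps / 2 * S).
{ intros s t Hs Ht. eapply Rle_trans. apply H1; apply Rabs_def1; lra.
  apply Rmult_le_compat_l; auto; lra. }
assert (E2 : forall s t, a <= s <= b -> c <= t <= d ->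
  Rabs (Q s t - Q x y - (q * (s - x) + qy * (t - y))) <= eps / 2 * S).
{ intros s t Hs Ht. eapply Rle_trans. apply H2; apply Rabs_def1; lra.
  apply Rmult_le_compat_l; auto; lra. }
assert (IP : forall t, c <= t <= d -> ex_RInt (fun s => P s t) a b)
  by (intros t Ht; eapply closed_form_ex_RInt with (c' := c) (d' := d) (x := x); eauto; lra).
assert (IQ : forall s, a <= s <= b -> ex_RInt (fun t => Q s t) c d)
  by (intros t Ht; eapply closed_form_ex_RInt with (a' := a) (b' := b) (y := y); eauto; lra).
assert (F1 : Rabs (RInt (fun s => P s c - P s d) a b - - (q * (d - c)) * (b - a)) <= eps * S * (b - a)).
{ apply RInt_near_const. lra.
  - apply (ex_RInt_minus (V := R_CompleteNormedModule) (fun s => P s c) (fun s => P s d)); apply IP; lra.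
  - intros t Ht. pose proof (E1 t c Ht ltac:(lra)) as A. pose proof (E1 t d Ht ltac:(lra)) as B.
    apply Rabs_le_between in A. apply Rabs_le_between in B. apply Rabs_le. lra. }
assert (F2 : Rabs (RInt (fun t => Q b t - Q a t) c d - (q * (b - a)) * (d - c)) <= eps * S * (d - c)).
{ apply RInt_near_const. lra.
  - apply (ex_RInt_minus (V := R_CompleteNormedModule) (fun s => Q b s) (fun s => Q a s)); apply IQ; lra.
  - intros t Ht. pose proof (E2 a t ltac:(lra) Ht) as A. pose proof (E2 b t ltac:(lra) Ht) as B.
    apply Rabs_le_between in A. apply Rabs_le_between in B. apply Rabs_le. lra. }
rewrite (RInt_minus (V := R_CompleteNormedModule) (fun s => P s c) (fun s => P s d)) in F1 by (apply IP; lra).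
rewrite (RInt_minus (V := R_CompleteNormedModule) (fun s => Q b s) (fun s => Q a s)) in F2 by (apply IQ; lra).
unfold minus, plus, opp in F1, F2; simpl in F1, F2.
apply Rabs_le_between in F1. apply Rabs_le_between in F2.
unfold rect_circulation. apply Rabs_le.
replace (eps * S ^ 2) with (eps * S * (b - a) + eps * S * (d - c)) by (unfold S; ring).
lra.
Qed.

(** The first quarter passing the test is taken, not the maximal one. The last quarter is a default;
    that it passes as well is shown in [worst_quarter_spec]. *)
Definition worst_quarter (P Q : R -> R -> R) (r : R * R * (R * R)) : R * R * (R * R) :=
  let '(a, b, (c, d)) := r in
  let m := (a + b) / 2 in
  let n := (c + d) / 2 in
  let J := Rabs (rect_circulation P Q a b c d) / 4 in
  if Rle_dec J (Rabs (rect_circulation P Q a m c n)) then (a, m, (c, n))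
  else if Rle_dec J (Rabs (rect_circulation P Q m b c n)) then (m, b, (c, n))
  else if Rle_dec J (Rabs (rect_circulation P Q a m n d)) then (a, m, (n, d))
  else (m, b, (n, d)).

Lemma closed_form_on_sub (P Q : R -> R -> R) (a b c d a' b' c' d' : R) :
  closed_form_on P Q a b c d -> a <= a' -> b' <= b -> c <= c' -> d' <= d ->
  closed_form_on P Q a' b' c' d'.
Proof. intros H ? ? ? ? x y Hx Hy. apply H; lra. Qed.

Lemma worst_quarter_spec (P Q : R -> R -> R) (a b c d : R) :
  a <= b -> c <= d -> closed_form_on P Q a b c d ->
  exists a' b' c' d', worst_quarter P Q (a, b, (c, d)) = (a', b', (c', d')) /\
    a <= a' /\ a' <= b' /\ b' <= b /\ c <= c' /\ c' <= d' /\ d' <= d /\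
    b' - a' = (b - a) / 2 /\ d' - c' = (d - c) / 2 /\
    Rabs (rect_circulation P Q a b c d) / 4 <= Rabs (rect_circulation P Q a' b' c' d').
Proof.
intros Hab Hcd H. unfold worst_quarter.
repeat (destruct (Rle_dec _ _)); try (do 4 eexists; split; [reflexivity|]; repeat split; lra).
(* Default branch: the other three quarters each carry less than a fourth of the total, so the
   triangle inequality gives the last one at least a fourth. *)
do 4 eexists; split; [reflexivity|]; repeat split; try lra.
rewrite (rect_circulation_quarter P Q a ((a + b) / 2) b c ((c + d) / 2) d) in * by (auto; lra).
set (A := rect_circulation P Q a ((a + b) / 2) c ((c + d) / 2)) in *.
set (B := rect_circulation P Q ((a + b) / 2) b c ((c + d) / 2)) in *.
set (D := rect_circulation P Q a ((a + b) / 2) ((c + d) / 2) d) in *.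
set (E := rect_circulation P Q ((a + b) / 2) b ((c + d) / 2) d) in *.
pose proof (Rabs_triang (A + B + D) E). pose proof (Rabs_triang (A + B) D). pose proof (Rabs_triang A B).
lra.
Qed.

(** Goursat's argument: quarter the rectangle, keeping a quarter that carries at
    least a fourth of the circulation, and compare with the local estimate at the
    limit point. *)
Theorem rect_circulation_closed (P Q : R -> R -> R) (a b c d : R) :
  a <= b -> c <= d -> closed_form_on P Q a b c d ->
  rect_circulation P Q a b c d = 0.
Proof.
intros Hab Hcd H.
destruct (Req_dec (rect_circulation P Q a b c d) 0) as [|Hne]; auto. exfalso.
set (J := Rabs (rect_circulation P Q a b c d)).
assert (HJ : 0 < J) by (apply Rabs_pos_lt; auto).
set (q := fun n => Nat.iter n (worst_quarter P Q) (a, b, (c, d))).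
set (A := fun n => fst (fst (q n))). set (B := fun n => snd (fst (q n))).
set (X := fun n => fst (snd (q n))). set (Y := fun n => snd (snd (q n))).
assert (Step : forall n, a <= A n -> A n <= B n -> B n <= b -> c <= X n -> X n <= Y n -> Y n <= d ->
   A n <= A (S n) /\ A (S n) <= B (S n) /\ B (S n) <= B n /\
   X n <= X (S n) /\ X (S n) <= Y (S n) /\ Y (S n) <= Y n /\
   B (S n) - A (S n) = (B n - A n) / 2 /\ Y (S n) - X (S n) = (Y n - X n) / 2 /\
   Rabs (rect_circulation P Q (A n) (B n) (X n) (Y n)) / 4
     <= Rabs (rect_circulation P Q (A (S n)) (B (S n)) (X (S n)) (Y (S n)))).
{ intros n I1 I2 I3 I4 I5 I6.
  assert (E : q n = (A n, B n, (X n, Y n)))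
    by (unfold A, B, X, Y; destruct (q n) as [[? ?] [? ?]]; reflexivity).
  destruct (worst_quarter_spec P Q (A n) (B n) (X n) (Y n)) as (a' & b' & c' & d' & E' & HH); auto.
  { eapply closed_form_on_sub; eauto. }
  rewrite <- E in E'. change (worst_quarter P Q (q n)) with (q (S n)) in E'.
  assert (A (S n) = a' /\ B (S n) = b' /\ X (S n) = c' /\ Y (S n) = d') as (-> & -> & -> & ->)
    by (unfold A, B, X, Y; rewrite E'; auto).
  exact HH. }
assert (I : forall n, a <= A n /\ A n <= B n /\ B n <= b /\ c <= X n /\ X n <= Y n /\ Y n <= d /\
   B n - A n = (b - a) / 2 ^ n /\ Y n - X n = (d - c) / 2 ^ n /\
   J / 4 ^ n <= Rabs (rect_circulation P Q (A n) (B n) (X n) (Y n))).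
{ intros n; induction n as [|n IH].
  - unfold A, B, X, Y; simpl. unfold J. repeat split; lra.
  - destruct IH as (I1 & I2 & I3 & I4 & I5 & I6 & I7 & I8 & I9).
    destruct (Step n) as (S1 & S2 & S3 & S4 & S5 & S6 & S7 & S8 & S9); auto.
    assert (0 < 2 ^ n) by (apply pow_lt; lra). assert (0 < 4 ^ n) by (apply pow_lt; lra).
    repeat split; try lra.
    + simpl. replace ((b - a) / (2 * 2 ^ n)) with ((b - a) / 2 ^ n / 2) by (field; lra). lra.
    + simpl. replace ((d - c) / (2 * 2 ^ n)) with ((d - c) / 2 ^ n / 2) by (field; lra). lra.
    + simpl. replace (J / (4 * 4 ^ n)) with (J / 4 ^ n / 4) by (field; lra). lra. }
assert (Mono : forall n k, (n <= k)%nat ->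
   A n <= A k /\ B k <= B n /\ X n <= X k /\ Y k <= Y n).
{ intros n k L; induction L as [|k L IH]. lra.
  destruct (I k) as (I1 & I2 & I3 & I4 & I5 & I6 & _).
  destruct (Step k) as (S1 & S2 & S3 & S4 & S5 & S6 & _); auto; lra. }
assert (AB : forall n k, A n <= B k /\ X n <= Y k).
{ intros n k.
  destruct (Mono n (max n k)) as (M1 & _ & M3 & _); [lia|].
  destruct (Mono k (max n k)) as (_ & M2 & _ & M4); [lia|].
  destruct (I (max n k)) as (_ & I2 & _ & _ & I5 & _). lra. }
(* The limit point has the suprema of the left and of the lower ends as coordinates; by [AB] every
   right or upper end bounds them, so it lies in all the rectangles. *)
destruct (completeness (fun x => exists n, x = A n)) as [x [Hx1 Hx2]].
{ exists b. intros ? [n ->]. apply Rle_trans with (B n); apply I. }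
{ exists (A 0%nat). exists 0%nat; auto. }
destruct (completeness (fun x => exists n, x = X n)) as [y [Hy1 Hy2]].
{ exists d. intros ? [n ->]. apply Rle_trans with (Y n); apply I. }
{ exists (X 0%nat). exists 0%nat; auto. }
assert (PA : forall n, A n <= x <= B n).
{ intros n. split. apply Hx1; eauto. apply Hx2. intros ? [k ->]. apply AB. }
assert (PX : forall n, X n <= y <= Y n).
{ intros n. split. apply Hy1; eauto. apply Hy2. intros ? [k ->]. apply AB. }
set (S0 := b - a + (d - c)).
assert (HS0 : 0 <= S0) by (unfold S0; lra).
assert (Hxy : closed_form_at P Q x y).
{ apply H. destruct (I 0%nat) as (?&?&?&?); specialize (PA 0%nat); lra.
  destruct (I 0%nat) as (?&?&?&?&?&?&?); specialize (PX 0%nat); lra. }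
(* With this tolerance the local bound at stage [n] is below [J / (2 * 4 ^ n)], against the retained
   [J / 4 ^ n]. The [+ 1] covers a degenerate rectangle with [S0 = 0]. *)
assert (Heps : 0 < J / (2 * (S0 ^ 2 + 1))) by (apply Rdiv_lt_0_compat; nra).
destruct (rect_circulation_local P Q x y _ Hxy Heps) as (delta & Hdelta & Hloc).
destruct (pow_lt_1_zero (1 / 2)) with (y := delta / (S0 + 1)) as [n Hn].
{ rewrite Rabs_pos_eq; lra. }
{ apply Rdiv_lt_0_compat; lra. }
specialize (Hn n (le_n n)).
assert (P2 : 0 < 2 ^ n) by (apply pow_lt; lra).
assert (E2 : (1 / 2) ^ n = / 2 ^ n) by (rewrite <- pow_inv; f_equal; lra).
rewrite E2, Rabs_pos_eq in Hn by (left; apply Rinv_0_lt_compat; auto).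
assert (Hs : S0 / 2 ^ n < delta).
{ assert (S0 * / 2 ^ n <= S0 * (delta / (S0 + 1))) by (apply Rmult_le_compat_l; lra).
  assert (S0 * (delta / (S0 + 1)) < delta).
  { apply Rmult_lt_reg_r with (S0 + 1). lra. field_simplify; lra. }
  unfold Rdiv; lra. }
destruct (I n) as (I1 & I2 & I3 & I4 & I5 & I6 & I7 & I8 & I9).
assert (B n - A n + (Y n - X n) = S0 / 2 ^ n) as E3 by (rewrite I7, I8; unfold S0; field; lra).
specialize (Hloc (A n) (B n) (X n) (Y n) (PA n) (PX n) ltac:(lra) ltac:(lra)
  ltac:(eapply closed_form_on_sub; eauto)).
rewrite E3 in Hloc.
assert (E4 : 4 ^ n = 2 ^ n * 2 ^ n) by (rewrite <- Rpow_mult_distr; f_equal; lra).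
rewrite E4 in I9.
assert (J / (2 ^ n * 2 ^ n) <= J / (2 * (S0 ^ 2 + 1)) * (S0 / 2 ^ n) ^ 2) as K by lra.
apply Rmult_le_compat_r with (r := 2 ^ n * 2 ^ n * (2 * (S0 ^ 2 + 1))) in K; [|nra].
field_simplify in K; try nra.
Qed.

(** * Complex differentiability and circle means *)

Lemma Cmod_sqr (z : C) : Cmod z ^ 2 = fst z ^ 2 + snd z ^ 2.
Proof. unfold Cmod. rewrite pow2_sqrt; nra. Qed.

Lemma is_derive_C_spec (f : C -> C) (z l : C) :
  is_derive (K := C_AbsRing) (V := C_NormedModule) f z l <->
  forall eps, 0 < eps -> exists delta, 0 < delta /\ forall w, Cmod (w - z) < delta ->
    Cmod (f w - f z - l * (w - z))%C <= eps * Cmod (w - z).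
Proof.
split.
- intros [_ H] eps He.
  destruct (H z (fun P HP => HP) (mkposreal _ He)) as [d Hd].
  exists d. split. apply cond_pos. intros w Hw. specialize (Hd w Hw).
  replace (l * (w - z))%C with ((w - z) * l)%C by ring. exact Hd.
- intros H. split. apply (is_linear_scal_l (K := C_AbsRing) (V := C_NormedModule)).
  intros x Hx. apply (is_filter_lim_locally_unique (K := C_AbsRing) (V := AbsRing_NormedModule C_AbsRing)) in Hx. subst x.
  intros eps. destruct (H eps (cond_pos eps)) as (d & Hd & HH).
  exists (mkposreal _ Hd). intros w Hw. specialize (HH w Hw).
  replace (l * (w - z))%C with ((w - z) * l)%C in HH by ring. exact HH.
Qed.

Notation is_Cderive := (is_derive (K := C_AbsRing) (V := C_NormedModule)).
Notation ex_Cderive := (ex_derive (K := C_AbsRing) (V := C_NormedModule)).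

(** Coquelicot's product and composition rules are stated over [AbsRing_NormedModule],
    which is not convertible to [C_NormedModule]. *)
Lemma is_Cderive_AbsRing (f : C -> C) (z l : C) :
  is_derive (K := C_AbsRing) (V := AbsRing_NormedModule C_AbsRing) f z l <-> is_Cderive f z l.
Proof.
split; intros [_ H]; (split; [|exact H]).
- apply (is_linear_scal_l (K := C_AbsRing) (V := C_NormedModule)).
- apply (is_linear_scal_l (K := C_AbsRing) (V := AbsRing_NormedModule C_AbsRing)).
Qed.

Lemma is_Cderive_const (c z : C) : is_Cderive (fun _ => c) z (RtoC 0).
Proof. exact (is_derive_const (K := C_AbsRing) (V := C_NormedModule) c z). Qed.

Lemma is_Cderive_id (z : C) : is_Cderive (fun w => w) z (RtoC 1).
Proof. apply is_Cderive_AbsRing. exact (is_derive_id (K := C_AbsRing) z). Qed.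

Lemma is_Cderive_plus (f g : C -> C) (z a b : C) :
  is_Cderive f z a -> is_Cderive g z b -> is_Cderive (fun w => f w + g w)%C z (a + b)%C.
Proof. exact (is_derive_plus (K := C_AbsRing) (V := C_NormedModule) f g z a b). Qed.

Lemma is_Cderive_minus (f g : C -> C) (z a b : C) :
  is_Cderive f z a -> is_Cderive g z b -> is_Cderive (fun w => f w - g w)%C z (a - b)%C.
Proof. exact (is_derive_minus (K := C_AbsRing) (V := C_NormedModule) f g z a b). Qed.

Lemma is_Cderive_mult (f g : C -> C) (z a b : C) :
  is_Cderive f z a -> is_Cderive g z b ->
  is_Cderive (fun w => f w * g w)%C z (a * g z + f z * b)%C.
Proof.
rewrite <- !is_Cderive_AbsRing. intros Hf Hg.
exact (is_derive_mult (K := C_AbsRing) f g z a b Hf Hg Cmult_comm).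
Qed.

Lemma is_Cderive_comp (f g : C -> C) (z a b : C) :
  is_Cderive f (g z) a -> is_Cderive g z b -> is_Cderive (fun w => f (g w)) z (b * a)%C.
Proof.
intros Hf Hg. apply is_Cderive_AbsRing in Hg.
exact (is_derive_comp (K := C_AbsRing) (V := C_NormedModule) f g z a b Hf Hg).
Qed.

Lemma is_Cderive_Cinv (z : C) : z <> 0 -> is_Cderive Cinv z (- / (z * z))%C.
Proof.
intros Hz. apply is_derive_C_spec. intros eps He.
assert (H0 : 0 < Cmod z) by (apply Cmod_gt_0; auto).
(* The first bound keeps [|w| > |z| / 2]; the second then makes the remainder
   [|w - z|^2 / (|z|^2 |w|)] at most [eps |w - z|]. *)
exists (Rmin (Cmod z / 2) (eps * Cmod z ^ 3 / 2)). split.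
{ assert (0 < Cmod z ^ 3) by (apply pow_lt; auto). apply Rmin_pos; nra. }
intros w Hw.
pose proof (Rmin_l (Cmod z / 2) (eps * Cmod z ^ 3 / 2)) as M1.
pose proof (Rmin_r (Cmod z / 2) (eps * Cmod z ^ 3 / 2)) as M2.
assert (Hwz : Cmod z / 2 < Cmod w).
{ pose proof (Cmod_triangle (z - w) w) as T. replace (z - w + w)%C with z in T by ring.
  replace (z - w)%C with (- (w - z))%C in T by ring. rewrite Cmod_opp in T. lra. }
assert (Hw0 : w <> 0) by (apply Cmod_gt_0; lra).
replace (/ w - / z - - / (z * z) * (w - z))%C with ((w - z) * (w - z) / (z * z * w))%C by (field; auto).
rewrite Cmod_div by (repeat apply Cmult_neq_0; auto). rewrite !Cmod_mult.
set (r := Cmod (w - z)) in *. assert (0 <= r) by apply Cmod_ge_0.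
assert (HD : 0 < Cmod z * Cmod z * Cmod w) by (repeat apply Rmult_lt_0_compat; lra).
apply Rmult_le_reg_r with (Cmod z * Cmod z * Cmod w); auto.
unfold Rdiv. rewrite Rmult_assoc, Rinv_l by lra. rewrite Rmult_1_r.
assert (r <= eps * (Cmod z * Cmod z * Cmod w)).
{ assert (0 < eps * (Cmod z * Cmod z) * (Cmod w - Cmod z / 2))
    by (apply Rmult_lt_0_compat; [nra | lra]). lra. }
nra.
Qed.

Lemma is_Cderive_inv (f : C -> C) (z a : C) :
  f z <> 0 -> is_Cderive f z a -> is_Cderive (fun w => / f w)%C z (a * - / (f z * f z))%C.
Proof. intros H0 H. apply (is_Cderive_comp Cinv f); auto. apply is_Cderive_Cinv; auto. Qed.

Lemma is_Cderive_eq (f : C -> C) (z a b : C) : is_Cderive f z a -> a = b -> is_Cderive f z b.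
Proof. now intros H <-. Qed.

Lemma ex_Cderive_const (c z : C) : ex_Cderive (fun _ => c) z.
Proof. eexists; apply is_Cderive_const. Qed.

Lemma ex_Cderive_id (z : C) : ex_Cderive (fun w => w) z.
Proof. eexists; apply is_Cderive_id. Qed.

Lemma ex_Cderive_plus (f g : C -> C) (z : C) :
  ex_Cderive f z -> ex_Cderive g z -> ex_Cderive (fun w => f w + g w)%C z.
Proof. intros [a Ha] [b Hb]. eexists; apply is_Cderive_plus; eauto. Qed.

Lemma ex_Cderive_minus (f g : C -> C) (z : C) :
  ex_Cderive f z -> ex_Cderive g z -> ex_Cderive (fun w => f w - g w)%C z.
Proof. intros [a Ha] [b Hb]. eexists; apply is_Cderive_minus; eauto. Qed.

Lemma ex_Cderive_opp (f : C -> C) (z : C) : ex_Cderive f z -> ex_Cderive (fun w => - f w)%C z.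
Proof. exact (ex_derive_opp (K := C_AbsRing) (V := C_NormedModule) f z). Qed.

Lemma ex_Cderive_mult (f g : C -> C) (z : C) :
  ex_Cderive f z -> ex_Cderive g z -> ex_Cderive (fun w => f w * g w)%C z.
Proof. intros [a Ha] [b Hb]. eexists; apply is_Cderive_mult; eauto. Qed.

Lemma ex_Cderive_div (f g : C -> C) (z : C) :
  g z <> 0 -> ex_Cderive f z -> ex_Cderive g z -> ex_Cderive (fun w => f w / g w)%C z.
Proof.
intros H0 [a Ha] [b Hb]. eexists. apply is_Cderive_mult; eauto. apply is_Cderive_inv; eauto.
Qed.

Lemma ex_Cderive_const_minus (c z : C) : ex_Cderive (fun w => c - w)%C z.
Proof. apply ex_Cderive_minus; [apply ex_Cderive_const | apply ex_Cderive_id]. Qed.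

Lemma ex_Cderive_minus_const (c z : C) : ex_Cderive (fun w => w - c)%C z.
Proof. apply ex_Cderive_minus; [apply ex_Cderive_id | apply ex_Cderive_const]. Qed.

Lemma ex_Cderive_comp (f g : C -> C) (z : C) :
  ex_Cderive f (g z) -> ex_Cderive g z -> ex_Cderive (fun w => f (g w)) z.
Proof. intros [a Ha] [b Hb]. eexists; apply is_Cderive_comp; eauto. Qed.

(** The Cauchy-Riemann equations: multiplication by [p + i q] has the real matrix with rows
    [(p, - q)] and [(q, p)]. The halvings in the proof absorb the factor [sqrt 2 <= 2] between the
    modulus and the max norm. *)
Lemma is_derive_C_components (f : C -> C) (x y p q : R) :
  is_Cderive f (x, y) (p, q) ->
  differentiable_pt_lim (fun u v => Re (f (u, v))) x y p (- q) /\
  differentiable_pt_lim (fun u v => Im (f (u, v))) x y q p.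
Proof.
intros H. rewrite is_derive_C_spec in H.
assert (K : forall eps : posreal, locally_2d (fun u v =>
  Cmod (f (u, v) - f (x, y) - (p, q) * ((u, v) - (x, y)))%C <= eps * Rmax (Rabs (u - x)) (Rabs (v - y))) x y).
{ intros eps. destruct (H (eps / 2)) as (d & Hd & HH). { apply Rdiv_lt_0_compat. apply cond_pos. lra. }
  assert (B : forall u v, Cmod ((u, v) - (x, y))%C <= 2 * Rmax (Rabs (u - x)) (Rabs (v - y))).
  { intros u v. eapply Rle_trans. apply Cmod_2Rmax. simpl.
    apply Rmult_le_compat_r. eapply Rle_trans; [apply Rabs_pos | apply Rmax_l].
    pose proof (sqrt_sqrt 2 ltac:(lra)). pose proof (sqrt_pos 2). nra. }
  assert (Hd2 : 0 < d / 2) by lra. exists (mkposreal _ Hd2). simpl. intros u v Hu Hv.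
  pose proof (B u v).
  assert (Rmax (Rabs (u - x)) (Rabs (v - y)) < d / 2) by (apply Rmax_lub_lt; auto).
  eapply Rle_trans. apply HH. lra.
  pose proof (cond_pos eps). nra. }
split; intros eps; destruct (K eps) as [d Hd]; exists d; intros u v Hu Hv; specialize (Hd u v Hu Hv);
  (eapply Rle_trans; [|exact Hd]); (eapply Rle_trans; [|apply Rmax_Cmod]).
- eapply Rle_trans; [|apply Rmax_l]. apply Req_le; f_equal; simpl; unfold Re; ring.
- eapply Rle_trans; [|apply Rmax_r]. apply Req_le; f_equal; simpl; unfold Im; ring.
Qed.

Lemma differentiable_pt_lim_Rmult (x y : R) :
  differentiable_pt_lim Rmult x y y x.
Proof.
intros eps. exists eps. intros u v Hu Hv.
replace (u * v - x * y - (y * (u - x) + x * (v - y))) with ((v - y) * (u - x)) by ring.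
rewrite Rabs_mult. apply Rmult_le_compat; try apply Rabs_pos. lra. apply Rmax_l.
Qed.

Lemma unit_phase (l : C) : l <> 0 -> exists c : C, Cmod c = 1 /\ (c * l)%C = RtoC (Cmod l).
Proof.
intros Hl. assert (HL : 0 < Cmod l) by (apply Cmod_gt_0; auto).
assert (HLC : RtoC (Cmod l) <> 0) by (intros E; apply RtoC_inj in E; lra).
exists (Cconj l / Cmod l)%C. split.
- rewrite Cmod_div by auto. rewrite Cmod_conj, Cmod_R, Rabs_pos_eq by lra. field. lra.
- replace (Cconj l / Cmod l * l)%C with ((l * Cconj l) / Cmod l)%C by (field; auto).
  rewrite <- Cmod2_conj, RtoC_pow. field; auto.
Qed.

Lemma Cconj_R (r : R) : Cconj r = r.
Proof. unfold Cconj, RtoC; simpl; f_equal; ring. Qed.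

Definition polar (x y : R) : C := (exp x * cos y, exp x * sin y).

Lemma differentiable_polar_re (x y : R) :
  differentiable_pt_lim (fun u v => exp u * cos v) x y (exp x * cos y) (- (exp x * sin y)).
Proof.
pose proof (differentiable_pt_lim_comp Rmult (fun u _ => exp u) (fun _ v => cos v) x y _ _ _ _ _ _
  (differentiable_pt_lim_Rmult _ _)
  (differentiable_pt_lim_proj1_0 exp x y _ (derivable_pt_lim_exp x))
  (differentiable_pt_lim_swap _ _ _ _ _ (differentiable_pt_lim_proj1_0 cos y x _ (derivable_pt_lim_cos y)))) as H.
simpl in H.
replace (exp x * cos y) with (cos y * exp x + exp x * 0) by ring.
replace (- (exp x * sin y)) with (cos y * 0 + exp x * - sin y) by ring. exact H.
Qed.

Lemma differentiable_polar_im (x y : R) :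
  differentiable_pt_lim (fun u v => exp u * sin v) x y (exp x * sin y) (exp x * cos y).
Proof.
pose proof (differentiable_pt_lim_comp Rmult (fun u _ => exp u) (fun _ v => sin v) x y _ _ _ _ _ _
  (differentiable_pt_lim_Rmult _ _)
  (differentiable_pt_lim_proj1_0 exp x y _ (derivable_pt_lim_exp x))
  (differentiable_pt_lim_swap _ _ _ _ _ (differentiable_pt_lim_proj1_0 sin y x _ (derivable_pt_lim_sin y)))) as H.
simpl in H.
replace (exp x * sin y) with (sin y * exp x + exp x * 0) by ring.
replace (exp x * cos y) with (sin y * 0 + exp x * cos y) by ring. exact H.
Qed.

Lemma Cmod_polar (x y : R) : Cmod (polar x y) = exp x.
Proof.
unfold Cmod, polar; simpl.
replace (_ + _) with (exp x ^ 2 * (Rsqr (sin y) + Rsqr (cos y))) by (unfold Rsqr; ring).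
rewrite sin2_cos2, Rmult_1_r. apply sqrt_pow2. left; apply exp_pos.
Qed.

(** In the coordinate [z = exp (u + i v)] this is the imaginary part of [g z dz / z], closed by
    Cauchy-Riemann. *)
Lemma closed_form_polar (g : C -> C) (x y : R) :
  ex_Cderive g (polar x y) ->
  closed_form_at (fun u v => Im (g (polar u v))) (fun u v => Re (g (polar u v))) x y.
Proof.
intros [[p q] H]. apply is_derive_C_components in H. destruct H as [HR HI].
pose proof (differentiable_pt_lim_comp _ _ _ _ _ _ _ _ _ _ _ HR (differentiable_polar_re x y) (differentiable_polar_im x y)) as H1.
pose proof (differentiable_pt_lim_comp _ _ _ _ _ _ _ _ _ _ _ HI (differentiable_polar_re x y) (differentiable_polar_im x y)) as H2.
do 3 eexists; split. exact H2.
replace (q * - (exp x * sin y) + p * (exp x * cos y)) with (p * (exp x * cos y) + - q * (exp x * sin y)) by ring.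
exact H1.
Qed.

(** [g] composed with the exponential is [2 i PI]-periodic, so on a rectangle of height
    [2 PI] the horizontal sides cancel and Goursat's lemma compares the vertical ones. *)
Lemma circle_mean_constant (g : C -> C) (a b : R) :
  (forall z, 0 < Cmod z < 1 -> ex_Cderive g z) ->
  a <= b -> b < 0 ->
  RInt (fun y => Re (g (polar a y))) 0 (2 * PI) = RInt (fun y => Re (g (polar b y))) 0 (2 * PI)
  /\ ex_RInt (fun y => Re (g (polar a y))) 0 (2 * PI).
Proof.
intros Hg Hab Hb. pose proof PI_RGT_0.
assert (H1 : closed_form_on (fun u v => Im (g (polar u v))) (fun u v => Re (g (polar u v))) a b 0 (2 * PI)).
{ intros x y Hx Hy. apply closed_form_polar, Hg. rewrite Cmod_polar. split. apply exp_pos.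
  rewrite <- exp_0. apply exp_increasing. lra. }
split.
- pose proof (rect_circulation_closed _ _ a b 0 (2 * PI) Hab ltac:(lra) H1) as E.
  unfold rect_circulation in E.
  rewrite (RInt_ext (fun x => Im (g (polar x (2 * PI)))) (fun x => Im (g (polar x 0)))) in E.
  + lra.
  + intros x _. unfold polar. now rewrite cos_2PI, sin_2PI, cos_0, sin_0.
- destruct (closed_form_ex_RInt _ _ a b 0 (2 * PI) a b 0 (2 * PI) 0 a H1) as [_ K]; try lra. exact K.
Qed.

(** The bound on a circle of radius close to [1] is carried to the origin by the
    constancy of circle means, which holds although [h] need not be defined at [0]. *)
Lemma removable_bound (h : C -> C) (l : C) :
  (forall z, 0 < Cmod z < 1 -> ex_Cderive h z) ->
  (forall z, 0 < Cmod z < 1 -> Cmod (h z) <= / Cmod z) ->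
  (forall eps, 0 < eps -> exists delta, 0 < delta /\
     forall z, 0 < Cmod z < delta -> Cmod (h z - l) <= eps) ->
  Cmod l <= 1.
Proof.
intros Hd Hb Hl.
destruct (Ceq_dec l 0) as [->|Hl0]. { rewrite Cmod_0; lra. }
(* After rotation by [c] the limit is the positive number [|l|], so real parts of circle means can
   be compared with it. *)
destruct (unit_phase l Hl0) as (c & Hc & Hcl).
pose proof PI_RGT_0 as HPI.
set (g := fun z => (c * h z)%C).
assert (Hg : forall z, 0 < Cmod z < 1 -> ex_Cderive g z).
{ intros z Hz. apply ex_Cderive_mult; auto. apply ex_Cderive_const. }
assert (K : forall b, b < 0 -> forall eps, 0 < eps -> Cmod l - eps <= exp (- b)).
{ intros b Hb0 eps He. destruct (Hl eps He) as (d & Hd0 & Hd1).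
  (* [exp a] is a small radius, where [h] is within [eps] of [l]; [exp b] is the large one, where
     the bound [1 / |z|] is read off. *)
  set (a := Rmin b (ln d - 1)).
  assert (Hab : a <= b) by apply Rmin_l.
  assert (Ha : exp a < d).
  { rewrite <- (exp_ln d) at 1 by auto. apply exp_increasing.
    pose proof (Rmin_r b (ln d - 1)). unfold a; lra. }
  destruct (circle_mean_constant g a b Hg Hab Hb0) as [E IA].
  destruct (circle_mean_constant g b b Hg (Rle_refl b) Hb0) as [_ IB].
  assert (LA : (Cmod l - eps) * (2 * PI) <= RInt (fun y => Re (g (polar a y))) 0 (2 * PI)).
  { replace ((Cmod l - eps) * (2 * PI)) with (RInt (fun _ => Cmod l - eps) 0 (2 * PI)).
    2:{ rewrite RInt_const. unfold scal; simpl; unfold mult; simpl. ring. }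
    apply RInt_le; auto. lra. apply ex_RInt_const.
    intros y Hy. assert (Hz : 0 < Cmod (polar a y) < d) by (rewrite Cmod_polar; split; auto; apply exp_pos).
    specialize (Hd1 _ Hz).
    assert (Cmod (g (polar a y) - c * l)%C <= eps).
    { unfold g. replace (c * h (polar a y) - c * l)%C with (c * (h (polar a y) - l))%C by ring.
      rewrite Cmod_mult, Hc. lra. }
    rewrite Hcl in H.
    pose proof (Rle_trans _ _ _ (re_le_Cmod (g (polar a y) - RtoC (Cmod l))) H) as M3.
    replace (Re (g (polar a y) - Cmod l)) with (Re (g (polar a y)) - Cmod l) in M3
      by (unfold Re, Cminus, Cplus, Copp, RtoC; cbn [fst snd]; ring).
    apply Rabs_le_between in M3. lra. }
  assert (LB : RInt (fun y => Re (g (polar b y))) 0 (2 * PI) <= exp (- b) * (2 * PI)).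
  { replace (exp (- b) * (2 * PI)) with (RInt (fun _ => exp (- b)) 0 (2 * PI)).
    2:{ rewrite RInt_const. unfold scal; simpl; unfold mult; simpl. ring. }
    apply RInt_le; auto. lra. apply ex_RInt_const.
    intros y Hy.
    assert (Hz : 0 < Cmod (polar b y) < 1).
    { rewrite Cmod_polar; split. apply exp_pos. rewrite <- exp_0. apply exp_increasing; lra. }
    specialize (Hb _ Hz). rewrite Cmod_polar, <- exp_Ropp in Hb.
    assert (Cmod (g (polar b y)) <= exp (- b)) by (unfold g; rewrite Cmod_mult, Hc; lra).
    eapply Rle_trans; [apply Rle_abs|]. eapply Rle_trans; [apply re_le_Cmod|]. lra. }
  apply Rmult_le_reg_r with (2 * PI). lra. lra. }
apply le_epsilon. intros eps He.
assert (H : Cmod l <= exp (ln (1 + eps / 2)) + eps / 2).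
{ assert (0 < ln (1 + eps / 2)) by (rewrite <- ln_1; apply ln_increasing; lra).
  pose proof (K (- ln (1 + eps / 2)) ltac:(lra) (eps / 2) ltac:(lra)) as K1.
  rewrite Ropp_involutive in K1. lra. }
rewrite exp_ln in H by lra. lra.
Qed.

(** * The Schwarz-Pick inequality *)

Lemma unit_disk_sqr (z : C) : unit_disk z <-> Cmod z ^ 2 < 1.
Proof. unfold unit_disk. pose proof (Cmod_ge_0 z). split; nra. Qed.

Lemma unit_disk_0 : unit_disk 0.
Proof. unfold unit_disk. rewrite Cmod_0. lra. Qed.

(** [phi z / z] is bounded by [1 / |z|] because [|phi| < 1], and it tends to [d] at the puncture. *)
Lemma schwarz_derivative (phi : C -> C) (d : C) :
  holomorphic_self_map phi -> phi 0 = 0 -> is_Cderive phi (RtoC 0) d -> Cmod d <= 1.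
Proof.
intros [Hh Hs] H0 Hd.
apply removable_bound with (fun z => phi z / z)%C.
- intros z [Hz Hz1]. apply ex_Cderive_div. now apply Cmod_gt_0. apply Hh; auto. apply ex_Cderive_id.
- intros z [Hz Hz1]. rewrite Cmod_div by now apply Cmod_gt_0.
  specialize (Hs z Hz1). unfold unit_disk in Hs. unfold Rdiv.
  rewrite <- (Rmult_1_l (/ Cmod z)) at 2. apply Rmult_le_compat_r.
  left; now apply Rinv_0_lt_compat. lra.
- intros eps He. rewrite is_derive_C_spec in Hd.
  destruct (Hd eps He) as (dl & Hdl & H). exists dl. split; auto. intros z [Hz Hz1].
  assert (Hz0 : z <> 0) by now apply Cmod_gt_0.
  specialize (H z). rewrite H0 in H. replace (z - 0)%C with z in H by ring.
  specialize (H Hz1).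
  replace (phi z / z - d)%C with ((phi z - 0 - d * z) / z)%C by (field; auto).
  rewrite Cmod_div by auto. apply Rmult_le_reg_r with (Cmod z); auto.
  unfold Rdiv. rewrite Rmult_assoc, Rinv_l by lra. lra.
Qed.

Definition mobius (a z : C) : C := ((z - a) / (1 - Cconj a * z))%C.

Lemma Cmod_mobius_identity (a z : C) :
  Cmod (1 - Cconj a * z) ^ 2 - Cmod (z - a) ^ 2 = (1 - Cmod a ^ 2) * (1 - Cmod z ^ 2).
Proof. rewrite !Cmod_sqr. destruct a, z; simpl. ring. Qed.

Lemma one_minus_conj_mult_neq_0 (a z : C) : unit_disk a -> unit_disk z -> (1 - Cconj a * z)%C <> 0.
Proof.
intros Ha Hz E.
assert (E1 : (Cconj a * z)%C = 1) by (replace (Cconj a * z)%C with (1 - (1 - Cconj a * z))%C by ring; rewrite E; ring).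
assert (E2 : Cmod (Cconj a * z) = 1) by (rewrite E1; apply Cmod_1).
rewrite Cmod_mult, Cmod_conj in E2. unfold unit_disk in *.
pose proof (Cmod_ge_0 a). pose proof (Cmod_ge_0 z). nra.
Qed.

Lemma one_minus_Cmod_mobius (a z : C) : unit_disk a -> unit_disk z ->
  1 - Cmod (mobius a z) ^ 2
  = (1 - Cmod a ^ 2) * (1 - Cmod z ^ 2) / Cmod (1 - Cconj a * z) ^ 2.
Proof.
intros Ha Hz. pose proof (one_minus_conj_mult_neq_0 a z Ha Hz) as H0.
unfold mobius. rewrite Cmod_div by auto. rewrite <- Cmod_mobius_identity. field.
apply Cmod_gt_0 in H0. lra.
Qed.

Lemma mobius_unit_disk (a z : C) : unit_disk a -> unit_disk z -> unit_disk (mobius a z).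
Proof.
intros Ha Hz. pose proof (one_minus_Cmod_mobius a z Ha Hz) as E.
pose proof (one_minus_conj_mult_neq_0 a z Ha Hz) as H0. apply Cmod_gt_0 in H0.
apply unit_disk_sqr. rewrite unit_disk_sqr in Ha, Hz.
assert (0 < (1 - Cmod a ^ 2) * (1 - Cmod z ^ 2) / Cmod (1 - Cconj a * z) ^ 2).
{ apply Rdiv_lt_0_compat. apply Rmult_lt_0_compat; lra. now apply pow_lt. }
lra.
Qed.

Lemma is_Cderive_mobius (a z : C) : unit_disk a -> unit_disk z ->
  is_Cderive (mobius a) z ((1 - a * Cconj a) / ((1 - Cconj a * z) * (1 - Cconj a * z)))%C.
Proof.
intros Ha Hz. pose proof (one_minus_conj_mult_neq_0 a z Ha Hz) as H0.
eapply is_Cderive_eq.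
- apply is_Cderive_mult.
  + apply is_Cderive_minus. apply is_Cderive_id. apply is_Cderive_const.
  + apply is_Cderive_inv; auto. apply is_Cderive_minus. apply is_Cderive_const.
    apply is_Cderive_mult. apply is_Cderive_const. apply is_Cderive_id.
- simpl. field. auto.
Qed.

Lemma holomorphic_self_map_mobius (a : C) : unit_disk a -> holomorphic_self_map (mobius a).
Proof.
intros Ha. split; intros z Hz. eexists; now apply is_Cderive_mobius. now apply mobius_unit_disk.
Qed.

Lemma holomorphic_self_map_comp (f g : C -> C) :
  holomorphic_self_map f -> holomorphic_self_map g -> holomorphic_self_map (fun z => f (g z)).
Proof.
intros [Hf Sf] [Hg Sg]. split; intros z Hz; auto. apply ex_Cderive_comp; auto.
Qed.

Lemma unit_disk_opp (a : C) : unit_disk a -> unit_disk (- a).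
Proof. unfold unit_disk. now rewrite Cmod_opp. Qed.

Lemma mobius_opp_0 (a : C) : mobius (- a) 0 = a.
Proof. unfold mobius. rewrite Cmult_0_r. field. Qed.

Lemma mobius_diag (a : C) : unit_disk a -> mobius a a = 0.
Proof. intros Ha. unfold mobius. field. now apply one_minus_conj_mult_neq_0. Qed.

Lemma mobius_opp_mobius (a z : C) : unit_disk a -> unit_disk z -> mobius (- a) (mobius a z) = z.
Proof.
intros Ha Hz. pose proof (one_minus_conj_mult_neq_0 a z Ha Hz). pose proof (one_minus_conj_mult_neq_0 a a Ha Ha).
unfold mobius. rewrite Copp_conj. field. split; auto.
replace (1 - Cconj a * z - - Cconj a * (z - a))%C with (1 - Cconj a * a)%C by ring. auto.
Qed.

Lemma one_minus_mult_conj (a : C) : (1 - a * Cconj a)%C = RtoC (1 - Cmod a ^ 2).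
Proof. rewrite <- Cmod2_conj. now rewrite RtoC_minus, RtoC_pow. Qed.

(** Moving [a] and [phi a] to [0] by Mobius maps multiplies the derivative by [1 - |a|^2] and by
    [1 / (1 - |phi a|^2)]. *)
Lemma schwarz_pick_derivative (phi : C -> C) (a d : C) :
  holomorphic_self_map phi -> unit_disk a -> is_Cderive phi a d ->
  Cmod d * (1 - Cmod a ^ 2) <= 1 - Cmod (phi a) ^ 2.
Proof.
intros Hphi Ha Hd. pose proof (proj2 Hphi a Ha) as Hb.
set (b := phi a) in *.
assert (P1 : Cmod a ^ 2 < 1) by now apply unit_disk_sqr.
assert (P2 : Cmod b ^ 2 < 1) by now apply unit_disk_sqr.
assert (H : Cmod ((1 - a * Cconj a) * d / (1 - b * Cconj b)) <= 1).
{ apply (schwarz_derivative (fun z => mobius b (phi (mobius (- a) z)))).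
  - apply holomorphic_self_map_comp. now apply holomorphic_self_map_mobius.
    apply holomorphic_self_map_comp; auto. now apply holomorphic_self_map_mobius, unit_disk_opp.
  - rewrite mobius_opp_0. now apply mobius_diag.
  - eapply is_Cderive_eq.
    + apply (is_Cderive_comp (mobius b)).
      * rewrite mobius_opp_0. fold b. apply is_Cderive_mobius; auto.
      * apply (is_Cderive_comp phi (mobius (- a))). rewrite mobius_opp_0; eauto.
        apply is_Cderive_mobius. now apply unit_disk_opp. apply unit_disk_0.
    + simpl. rewrite Copp_conj. rewrite (Cmult_comm (Cconj b) b).
      field. rewrite Cmult_comm. now apply (one_minus_conj_mult_neq_0 b b). }
rewrite !one_minus_mult_conj in H.
assert (RtoC (1 - Cmod b ^ 2) <> 0) by (intros E; apply RtoC_inj in E; lra).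
rewrite Cmod_div, Cmod_mult, !Cmod_R, !Rabs_pos_eq in H by (auto; lra).
apply Rmult_le_compat_r with (r := 1 - Cmod b ^ 2) in H; [|lra].
unfold Rdiv in H. rewrite Rmult_assoc, Rinv_l in H by lra. lra.
Qed.

(** The hyperbolic speed of [x] is at most that of [t -> rho t], and both start at [0], so [x]
    cannot overtake. *)
Lemma hyperbolic_speed_comparison (x dx : R -> R) (rho : R) :
  0 <= rho < 1 -> x 0 = 0 ->
  (forall t, 0 <= t <= 1 -> is_derive x t (dx t) /\ Rabs (x t) < 1 /\
     dx t * (1 - rho ^ 2 * t ^ 2) <= rho * (1 - x t ^ 2)) ->
  x 1 <= rho.
Proof.
intros Hr H0 H.
(* [W] is [exp (2 (artanh (x t) - artanh (rho t)))]; the hypothesis says it decreases. *)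
set (W := fun t => (1 + x t) * (1 - rho * t) / ((1 - x t) * (1 + rho * t))).
set (dW := fun t => (2 * (dx t * (1 - rho ^ 2 * t ^ 2)) - 2 * (rho * (1 - x t ^ 2)))
                    / ((1 - x t) * (1 + rho * t)) ^ 2).
assert (Pos : forall t, 0 <= t <= 1 -> 0 < 1 - x t /\ 0 < 1 + x t /\ 0 < 1 + rho * t /\ 0 < 1 - rho * t).
{ intros t Ht. destruct (H t Ht) as (_ & Hx & _). apply Rabs_def2 in Hx. nra. }
assert (D : forall t, 0 <= t <= 1 -> is_derive W t (dW t)).
{ intros t Ht. destruct (H t Ht) as (Hx & _). destruct (Pos t Ht) as (p1 & p2 & p3 & p4).
  unfold W. auto_derive.
  - split. eexists; eauto. split; [eexists; eauto|]. split; auto. apply Rmult_integral_contrapositive; lra.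
  - change (Derive (fun x0 : R => x x0) t) with (Derive x t).
    rewrite (is_derive_unique x t (dx t) Hx). unfold dW. field. lra. }
destruct (MVT_gen W 0 1 dW) as (c & Hc & E).
- intros t. rewrite Rmin_left, Rmax_right by lra. intros Ht. apply D; lra.
- intros t. rewrite Rmin_left, Rmax_right by lra. intros Ht.
  apply derivable_continuous_pt. exists (dW t). apply is_derive_Reals. apply D; lra.
- rewrite Rmin_left, Rmax_right in Hc by lra.
  assert (dW c <= 0).
  { destruct (H c Hc) as (_ & _ & Hx). destruct (Pos c Hc) as (p1 & p2 & p3 & p4).
    unfold dW. apply Rmult_le_reg_r with (((1 - x c) * (1 + rho * c)) ^ 2).
    apply pow_lt. now apply Rmult_lt_0_compat. unfold Rdiv. rewrite Rmult_assoc, Rinv_l.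
    lra. apply pow_nonzero. apply Rmult_integral_contrapositive; lra. }
  assert (W 0 = 1) by (unfold W; rewrite H0; field).
  assert (W1 : W 1 <= 1) by nra. unfold W in W1.
  destruct (Pos 1 ltac:(lra)) as (p1 & p2 & p3 & p4).
  apply Rmult_le_compat_r with (r := (1 - x 1) * (1 + rho * 1)) in W1.
  2:{ left. now apply Rmult_lt_0_compat. }
  unfold Rdiv in W1. rewrite Rmult_assoc, Rinv_l in W1 by (apply Rmult_integral_contrapositive; lra). lra.
Qed.

(** The derivative bound is integrated along the segment from [0] to [z], whose image moves no
    faster in the hyperbolic metric than the segment. *)
Theorem schwarz (phi : C -> C) (z : C) :
  holomorphic_self_map phi -> phi 0 = 0 -> unit_disk z -> Cmod (phi z) <= Cmod z.
Proof.
intros Hphi H0 Hz. pose proof (Cmod_ge_0 z).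
destruct (Ceq_dec (phi z) 0) as [->|Hn]. { rewrite Cmod_0. lra. }
destruct (unit_phase (phi z) Hn) as (c & Hc & Hcl).
assert (Htz : forall t, 0 <= t <= 1 -> Cmod (t * z) = t * Cmod z /\ unit_disk (t * z)).
{ intros t Ht. assert (Cmod (t * z) = t * Cmod z) by (rewrite Cmod_mult, Cmod_R, Rabs_pos_eq by lra; auto).
  split; auto. unfold unit_disk in *. nra. }
(* The rotated real part equals the modulus at the endpoint, which turns the claim into a scalar
   comparison with [rho = |z|]. *)
replace (Cmod (phi z)) with (Re (c * phi (1 * z))%C) by (rewrite Cmult_1_l, Hcl; auto).
apply (hyperbolic_speed_comparison (fun t => Re (c * phi (t * z))%C) (fun t => Re (c * C_derive phi (t * z) * z))%C).
- split; auto.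
- replace (0 * z)%C with (RtoC 0) by ring. rewrite H0, Cmult_0_r. auto.
- intros t Ht. destruct (Htz t Ht) as [Et Dt].
  assert (Hd : is_Cderive phi (t * z)%C (C_derive phi (t * z))) by (apply C_derive_correct; [exact z | now apply Hphi]).
  pose proof (schwarz_pick_derivative phi _ _ Hphi Dt Hd) as SP.
  pose proof (proj2 Hphi _ Dt) as Hu. unfold unit_disk in Hu.
  set (d := C_derive phi (t * z)) in *. set (v := phi (t * z)%C) in *.
  assert (Hx : Rabs (Re (c * v)) <= Cmod v) by (eapply Rle_trans; [apply re_le_Cmod|]; rewrite Cmod_mult, Hc; lra).
  split; [|split].
  + assert (Hg : is_Cderive (fun w => c * phi w)%C (t * z)%C (c * d)%C).
    { eapply is_Cderive_eq. apply is_Cderive_mult. apply is_Cderive_const. exact Hd. simpl; ring. }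
    assert (E1 : forall s : R, (s * z)%C = (s * fst z, s * snd z)).
    { intros s. destruct z. unfold Cmult; simpl. f_equal; ring. }
    destruct (c * d)%C as [p q] eqn:Ecd. rewrite E1 in Hg.
    apply is_derive_C_components in Hg. destruct Hg as [Hg _].
    apply is_derive_Reals.
    replace (Re ((p, q) * z)) with (p * fst z + - q * snd z) by (unfold Re; simpl; ring).
    pose proof (derivable_pt_lim_comp_2d _ (fun s => s * fst z) (fun s => s * snd z) t _ _ (fst z) (snd z) Hg) as K.
    apply is_derive_Reals. apply is_derive_ext with (fun s : R => Re (c * phi ((s * fst z)%R, (s * snd z)%R))%C).
    { intros s. now rewrite E1. }
    apply is_derive_Reals. apply K; apply is_derive_Reals; auto_derive; auto; ring.
  + lra.
  + assert (Hd1 : Re (c * d * z) <= Cmod d * Cmod z).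
    { eapply Rle_trans; [apply Rle_abs|]. eapply Rle_trans; [apply re_le_Cmod|]. rewrite !Cmod_mult, Hc. lra. }
    rewrite Et in SP.
    assert (Re (c * v) ^ 2 <= Cmod v ^ 2) by (apply pow_maj_Rabs; auto).
    assert (0 <= 1 - (t * Cmod z) ^ 2).
    { unfold unit_disk in Dt. rewrite Et in Dt. assert (0 <= t * Cmod z) by (apply Rmult_le_pos; lra). nra. }
    (* The infinitesimal inequality trades [|d| (1 - |t z|^2)] for [1 - |v|^2]; replacing [v] by its
       rotated real part only enlarges this defect. *)
    apply Rle_trans with (Cmod d * Cmod z * (1 - (t * Cmod z) ^ 2)).
    { replace (1 - Cmod z ^ 2 * t ^ 2) with (1 - (t * Cmod z) ^ 2) by ring. now apply Rmult_le_compat_r. }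
    apply Rle_trans with (Cmod z * (1 - Cmod v ^ 2)). { nra. }
    apply Rmult_le_compat_l; lra.
Qed.

(** Schwarz's lemma between Mobius maps, with denominators cleared: the defects [1 - |.|^2] become
    separate factors that can be rescaled when a point goes to the boundary. *)
Theorem schwarz_pick (phi : C -> C) (z w : C) :
  holomorphic_self_map phi -> unit_disk z -> unit_disk w ->
  (1 - Cmod z ^ 2) * (1 - Cmod w ^ 2) * Cmod (1 - Cconj (phi w) * phi z) ^ 2
  <= (1 - Cmod (phi z) ^ 2) * (1 - Cmod (phi w) ^ 2) * Cmod (1 - Cconj w * z) ^ 2.
Proof.
intros Hphi Hz Hw. pose proof (proj2 Hphi z Hz) as Hz'. pose proof (proj2 Hphi w Hw) as Hw'.
assert (H : Cmod (mobius (phi w) (phi z)) <= Cmod (mobius w z)).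
{ rewrite <- (mobius_opp_mobius w z) at 1 by auto.
  apply (schwarz (fun u => mobius (phi w) (phi (mobius (- w) u)))).
  - apply holomorphic_self_map_comp. now apply holomorphic_self_map_mobius.
    apply holomorphic_self_map_comp; auto. now apply holomorphic_self_map_mobius, unit_disk_opp.
  - rewrite mobius_opp_0. now apply mobius_diag.
  - now apply mobius_unit_disk. }
assert (H2 : Cmod (mobius (phi w) (phi z)) ^ 2 <= Cmod (mobius w z) ^ 2).
{ apply pow_incr. split; auto. apply Cmod_ge_0. }
assert (H3 : 1 - Cmod (mobius w z) ^ 2 <= 1 - Cmod (mobius (phi w) (phi z)) ^ 2) by lra.
rewrite !one_minus_Cmod_mobius in H3 by auto.
pose proof (one_minus_conj_mult_neq_0 w z Hw Hz) as N1. pose proof (one_minus_conj_mult_neq_0 _ _ Hw' Hz') as N2.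
apply Cmod_gt_0, (pow_lt _ 2) in N1. apply Cmod_gt_0, (pow_lt _ 2) in N2.
set (A := Cmod (1 - Cconj w * z) ^ 2) in *. set (B := Cmod (1 - Cconj (phi w) * phi z) ^ 2) in *.
apply Rmult_le_compat_r with (r := A * B) in H3; [|nra].
replace ((1 - Cmod w ^ 2) * (1 - Cmod z ^ 2) / A * (A * B))
  with ((1 - Cmod z ^ 2) * (1 - Cmod w ^ 2) * B) in H3 by (field; lra).
replace ((1 - Cmod (phi w) ^ 2) * (1 - Cmod (phi z) ^ 2) / B * (A * B))
  with ((1 - Cmod (phi z) ^ 2) * (1 - Cmod (phi w) ^ 2) * A) in H3 by (field; lra).
exact H3.
Qed.

(** * Functions with nonnegative real part *)

(** [phi] is the Cayley transform of [G]; strict positivity puts its values in the open disk. *)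
Lemma schwarz_pick_half_plane_strict (G : C -> C) (z w : C) :
  holomorphic_on_disk G -> (forall u, unit_disk u -> 0 < Re (G u)) ->
  unit_disk z -> unit_disk w ->
  Cmod (G z + Cconj (G w)) ^ 2 * ((1 - Cmod z ^ 2) * (1 - Cmod w ^ 2))
  <= 4 * Re (G z) * Re (G w) * Cmod (1 - Cconj w * z) ^ 2.
Proof.
intros HG Hp Hz Hw.
assert (N : forall u, unit_disk u -> (G u + 1)%C <> 0).
{ intros u Hu E. specialize (Hp u Hu). apply (f_equal Re) in E. unfold Re in *; simpl in E. lra. }
set (phi := fun u => ((G u - 1) / (G u + 1))%C).
assert (M : forall u, unit_disk u -> 1 - Cmod (phi u) ^ 2 = 4 * Re (G u) / Cmod (G u + 1) ^ 2).
{ intros u Hu. unfold phi. rewrite Cmod_div by auto. pose proof (proj1 (Cmod_gt_0 _) (N u Hu)).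
  replace (4 * Re (G u)) with (Cmod (G u + 1) ^ 2 - Cmod (G u - 1) ^ 2).
  field; lra. rewrite !Cmod_sqr. unfold Re. destruct (G u); simpl. ring. }
assert (Hphi : holomorphic_self_map phi).
{ split; intros u Hu.
  - apply ex_Cderive_div; auto. apply ex_Cderive_minus; [now apply HG | apply ex_Cderive_const].
    apply ex_Cderive_plus; [now apply HG | apply ex_Cderive_const].
  - apply unit_disk_sqr. pose proof (M u Hu). specialize (Hp u Hu).
    pose proof (proj1 (Cmod_gt_0 _) (N u Hu)).
    assert (0 < 4 * Re (G u) / Cmod (G u + 1) ^ 2) by (apply Rdiv_lt_0_compat; [lra | now apply pow_lt]).
    lra. }
pose proof (schwarz_pick phi z w Hphi Hz Hw) as H.
rewrite (M z Hz), (M w Hw) in H.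
assert (Nw : (Cconj (G w) + 1)%C <> 0).
{ intros E. apply (N w Hw). rewrite <- (Cconj_conj (G w + 1)). rewrite Cplus_conj.
  rewrite Cconj_R, E. apply Cconj_R. }
assert (E : (1 - Cconj (phi w) * phi z)%C = (2 * (G z + Cconj (G w)) / ((G z + 1) * (Cconj (G w) + 1)))%C).
{ unfold phi. rewrite Cdiv_conj by auto. rewrite Cminus_conj, Cplus_conj, Cconj_R.
  field. auto. }
rewrite E, Cmod_div, !Cmod_mult, Cmod_R, Rabs_pos_eq in H by (try apply Cmult_neq_0; auto; lra).
replace (Cmod (Cconj (G w) + 1)) with (Cmod (G w + 1)) in H.
2:{ rewrite <- (Cmod_conj (G w + 1)), Cplus_conj, Cconj_R. auto. }
pose proof (proj1 (Cmod_gt_0 _) (N z Hz)) as A. pose proof (proj1 (Cmod_gt_0 _) (N w Hw)) as B.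
apply Rmult_le_compat_r with (r := (Cmod (G z + 1) * Cmod (G w + 1)) ^ 2 / 4) in H.
2:{ assert (0 < (Cmod (G z + 1) * Cmod (G w + 1)) ^ 2) by (apply pow_lt; nra). lra. }
match type of H with ?l <= ?r =>
  replace l with (Cmod (G z + Cconj (G w)) ^ 2 * ((1 - Cmod z ^ 2) * (1 - Cmod w ^ 2))) in H by (field; lra);
  replace r with (4 * Re (G z) * Re (G w) * Cmod (1 - Cconj w * z) ^ 2) in H by (field; lra)
end.
exact H.
Qed.

Lemma quadratic_at_0_nonneg (a b c : R) :
  (forall eps, 0 < eps -> 0 <= a + b * eps + c * eps ^ 2) -> 0 <= a.
Proof.
intros H. apply Rnot_lt_le. intros Ha.
set (D := Rabs b + Rabs c + 1).
assert (HD : 1 <= D) by (unfold D; pose proof (Rabs_pos b); pose proof (Rabs_pos c); lra).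
(* Here [e D <= - a / 2], and [e <= 1] allows [e ^ 2] to be bounded by [e]. *)
set (e := Rmin 1 (- a / (2 * D))).
assert (He : 0 < e) by (apply Rmin_pos; [lra | apply Rdiv_lt_0_compat; lra]).
assert (e <= 1) by apply Rmin_l.
assert (e * (2 * D) <= - a).
{ apply Rle_trans with (- a / (2 * D) * (2 * D)). apply Rmult_le_compat_r. lra. apply Rmin_r.
  right; field; lra. }
specialize (H e He). pose proof (Rle_abs b). pose proof (Rle_abs c).
assert (b * e <= Rabs b * e) by (apply Rmult_le_compat_r; lra).
assert (c * e ^ 2 <= Rabs c * e).
{ pose proof (Rabs_pos c). assert (e ^ 2 <= e) by nra. assert (0 <= e ^ 2) by nra. nra. }
unfold D in *. nra.
Qed.

(** Applying the strict case to [G + eps] and letting [eps] tend to [0]. *)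
Theorem schwarz_pick_half_plane (G : C -> C) (z w : C) :
  holomorphic_on_disk G -> (forall u, unit_disk u -> 0 <= Re (G u)) ->
  unit_disk z -> unit_disk w ->
  Cmod (G z + Cconj (G w)) ^ 2 * ((1 - Cmod z ^ 2) * (1 - Cmod w ^ 2))
  <= 4 * Re (G z) * Re (G w) * Cmod (1 - Cconj w * z) ^ 2.
Proof.
intros HG Hp Hz Hw.
set (A := (1 - Cmod z ^ 2) * (1 - Cmod w ^ 2)). set (B := Cmod (1 - Cconj w * z) ^ 2).
apply Rge_le, Rminus_ge, Rle_ge.
(* [b] and [c] are the coefficients of [eps] and [eps ^ 2] in the right side minus the left side of
   the inequality for [G + eps]. *)
apply quadratic_at_0_nonneg with
  (b := 4 * (Re (G z) + Re (G w)) * B - 4 * (Re (G z) + Re (G w)) * A) (c := 4 * B - 4 * A).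
intros eps He.
pose proof (schwarz_pick_half_plane_strict (fun u => G u + eps)%C z w) as H. cbv beta in H. fold A B in H.
assert (E : forall u, Re (G u + eps) = Re (G u) + eps) by (intros; unfold Re; reflexivity).
rewrite !E in H.
replace (Cmod (G z + eps + Cconj (G w + eps)) ^ 2)
  with (Cmod (G z + Cconj (G w)) ^ 2 + 4 * (Re (G z) + Re (G w)) * eps + 4 * eps ^ 2) in H.
2:{ rewrite !Cmod_sqr. unfold Re. destruct (G z), (G w); simpl. ring. }
assert (K : (Cmod (G z + Cconj (G w)) ^ 2 + 4 * (Re (G z) + Re (G w)) * eps + 4 * eps ^ 2) * A
   <= 4 * (Re (G z) + eps) * (Re (G w) + eps) * B).
{ apply H; auto.
  - intros u Hu. apply ex_Cderive_plus; [now apply HG | apply ex_Cderive_const].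
  - intros u Hu. rewrite E. specialize (Hp u Hu). lra. }
lra.
Qed.

(** * Sequential limits and radial approach to the boundary *)

Definition is_Clim_seq (u : nat -> C) (l : C) : Prop :=
  is_lim_seq (fun k => Re (u k)) (Re l) /\ is_lim_seq (fun k => Im (u k)) (Im l).

Lemma is_Clim_seq_locally (u : nat -> C) (l : C) :
  filterlim u eventually (locally l) -> is_Clim_seq u l.
Proof.
destruct l as [a b]. intros H.
assert (K : forall e : posreal, eventually (fun k => Rabs (Re (u k) - a) < e /\ Rabs (Im (u k) - b) < e)).
{ intros e. apply (H (fun w => Rabs (Re w - a) < e /\ Rabs (Im w - b) < e)).
  exists e. intros y Hy. exact Hy. }
split; apply is_lim_seq_spec; intros e; generalize (K e); apply filter_imp; intros k; simpl; tauto.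
Qed.

Lemma is_Clim_seq_unique (u : nat -> C) (l l' : C) :
  is_Clim_seq u l -> is_Clim_seq u l' -> l = l'.
Proof.
intros [H1 H2] [H3 H4].
apply is_lim_seq_unique in H1, H2, H3, H4. rewrite H1 in H3. rewrite H2 in H4.
destruct l, l'. unfold Re, Im in *; simpl in *. congruence.
Qed.

Lemma is_Clim_seq_ext (u v : nat -> C) (l : C) :
  (forall k, u k = v k) -> is_Clim_seq u l -> is_Clim_seq v l.
Proof.
intros E [H1 H2]. split; [apply is_lim_seq_ext with (fun k => Re (u k)) | apply is_lim_seq_ext with (fun k => Im (u k))];
  auto; intros k; now rewrite E.
Qed.

Lemma is_Clim_seq_const (c : C) : is_Clim_seq (fun _ => c) c.
Proof. split; apply is_lim_seq_const. Qed.

Lemma is_Clim_seq_RtoC (u : nat -> R) (l : R) :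
  is_lim_seq u l -> is_Clim_seq (fun k => RtoC (u k)) l.
Proof. intros H. split; simpl; auto. apply is_lim_seq_const. Qed.

Lemma is_Clim_seq_plus (u v : nat -> C) (a b : C) :
  is_Clim_seq u a -> is_Clim_seq v b -> is_Clim_seq (fun k => u k + v k)%C (a + b)%C.
Proof.
intros [H1 H2] [H3 H4]. split.
- exact (is_lim_seq_plus' _ _ _ _ H1 H3).
- exact (is_lim_seq_plus' _ _ _ _ H2 H4).
Qed.

Lemma is_Clim_seq_mult (u v : nat -> C) (a b : C) :
  is_Clim_seq u a -> is_Clim_seq v b -> is_Clim_seq (fun k => u k * v k)%C (a * b)%C.
Proof.
intros [H1 H2] [H3 H4]. split.
- exact (is_lim_seq_minus' _ _ _ _ (is_lim_seq_mult' _ _ _ _ H1 H3) (is_lim_seq_mult' _ _ _ _ H2 H4)).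
- exact (is_lim_seq_plus' _ _ _ _ (is_lim_seq_mult' _ _ _ _ H1 H4) (is_lim_seq_mult' _ _ _ _ H2 H3)).
Qed.

Lemma is_Clim_seq_minus (u v : nat -> C) (a b : C) :
  is_Clim_seq u a -> is_Clim_seq v b -> is_Clim_seq (fun k => u k - v k)%C (a - b)%C.
Proof.
intros [H1 H2] [H3 H4]. split.
- exact (is_lim_seq_minus' _ _ _ _ H1 H3).
- exact (is_lim_seq_minus' _ _ _ _ H2 H4).
Qed.

Lemma is_Clim_seq_conj (u : nat -> C) (a : C) :
  is_Clim_seq u a -> is_Clim_seq (fun k => Cconj (u k)) (Cconj a).
Proof.
intros [H1 H2]. split; auto. exact (proj1 (is_lim_seq_opp _ _) H2).
Qed.

Lemma is_lim_seq_Cmod_sqr (u : nat -> C) (a : C) :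
  is_Clim_seq u a -> is_lim_seq (fun k => Cmod (u k) ^ 2) (Cmod a ^ 2).
Proof.
intros [H1 H2].
replace (Cmod a ^ 2) with (Re a * Re a + Im a * Im a) by (rewrite Cmod2_alt; ring).
apply is_lim_seq_ext with (fun k => Re (u k) * Re (u k) + Im (u k) * Im (u k)).
- intros k. rewrite Cmod2_alt. ring.
- exact (is_lim_seq_plus' _ _ _ _ (is_lim_seq_mult' _ _ _ _ H1 H1) (is_lim_seq_mult' _ _ _ _ H2 H2)).
Qed.

Lemma is_Clim_seq_inv (u : nat -> C) (a : C) :
  a <> 0 -> is_Clim_seq u a -> is_Clim_seq (fun k => / u k)%C (/ a)%C.
Proof.
intros Ha Hu. pose proof (is_lim_seq_Cmod_sqr u a Hu) as HM.
assert (HM0 : Cmod a ^ 2 <> 0) by (apply Cmod_gt_0 in Ha; apply pow_nonzero; lra).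
destruct Hu as [H1 H2].
rewrite Cmod2_alt in HM, HM0.
assert (HM' : is_lim_seq (fun k => Re (u k) ^ 2 + Im (u k) ^ 2) (Re a ^ 2 + Im a ^ 2))
  by (eapply is_lim_seq_ext; [|exact HM]; intros k; apply Cmod2_alt).
split.
- exact (is_lim_seq_div' _ _ _ _ H1 HM' HM0).
- exact (is_lim_seq_div' _ _ _ _ (proj1 (is_lim_seq_opp _ _) H2) HM' HM0).
Qed.

(** The [+ 2] keeps the value strictly between [0] and [1] even at [k = 0]. It serves both as
    distance to the circle and, in [generator_half_plane], as a time tending to [0]. *)
Definition gap (k : nat) : R := / (INR k + 2).

Lemma gap_bounds (k : nat) : 0 < gap k < 1.
Proof.
unfold gap. pose proof (pos_INR k). split. apply Rinv_0_lt_compat; lra.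
rewrite <- Rinv_1. apply Rinv_lt_contravar; lra.
Qed.

Lemma is_lim_seq_gap : is_lim_seq gap 0.
Proof.
apply (is_lim_seq_inv (fun k => INR k + 2) p_infty). 2: discriminate.
apply (is_lim_seq_plus INR (fun _ => 2) p_infty 2 p_infty).
apply is_lim_seq_INR. apply is_lim_seq_const. reflexivity.
Qed.

Definition radial (zeta : C) (k : nat) : C := (RtoC (1 - gap k) * zeta)%C.

Lemma Cmod_radial (zeta : C) (k : nat) : Cmod zeta = 1 -> Cmod (radial zeta k) = 1 - gap k.
Proof.
intros H. pose proof (gap_bounds k). unfold radial.
rewrite Cmod_mult, Cmod_R, Rabs_pos_eq, H by lra. ring.
Qed.

Lemma unit_disk_radial (zeta : C) (k : nat) : Cmod zeta = 1 -> unit_disk (radial zeta k).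
Proof. intros H. unfold unit_disk. rewrite Cmod_radial by auto. pose proof (gap_bounds k). lra. Qed.

Lemma is_Clim_seq_radial (zeta : C) : is_Clim_seq (radial zeta) zeta.
Proof.
replace zeta with (RtoC (1 - 0) * zeta)%C at 2 by (rewrite Rminus_0_r; ring).
apply is_Clim_seq_mult. 2: apply is_Clim_seq_const.
apply is_Clim_seq_RtoC. apply (is_lim_seq_minus' _ _ _ _ (is_lim_seq_const 1) is_lim_seq_gap).
Qed.

(** The radius lies in every Stolz region since [|r zeta - zeta| = 1 - |r zeta|]; the aperture [2]
    is merely a value above [1]. *)
Lemma angular_limit_radial (g : C -> C) (zeta l : C) :
  Cmod zeta = 1 -> angular_limit g zeta l -> is_Clim_seq (fun k => g (radial zeta k)) l.
Proof.
intros Hz H. apply is_Clim_seq_locally.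
apply (filterlim_comp _ _ _ (radial zeta) g _ _ _) with (2 := H 2 ltac:(lra)).
destruct (is_Clim_seq_radial zeta) as [H1 H2].
apply is_lim_seq_spec in H1, H2.
intros P [e He]. unfold filtermap.
generalize (filter_and _ _ (H1 e) (H2 e)). apply filter_imp. intros k [K1 K2].
apply He.
- split; [exact K1 | exact K2].
- unfold stolz_region. rewrite Cmod_radial by auto. pose proof (gap_bounds k).
  replace (radial zeta k - zeta)%C with (RtoC (- gap k) * zeta)%C
    by (unfold radial; rewrite RtoC_minus, RtoC_opp; ring).
  rewrite Cmod_mult, Cmod_R, Rabs_Ropp, Rabs_pos_eq, Hz by lra. lra.
Qed.

(** Radial growth [kappa / (1 - r)] is that of a mass [kappa / 2], and [Re G] dominates the Poisson
    kernel of this mass. Multiplying the two-point inequality by [gap k], on top of the [gap k]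
    contained in [1 - |w|^2], gives both sides finite limits. *)
Theorem julia_point_mass (G : C -> C) (zeta : C) (kappa : R) (z : C) :
  holomorphic_on_disk G -> (forall u, unit_disk u -> 0 <= Re (G u)) ->
  Cmod zeta = 1 -> 0 < kappa ->
  is_Clim_seq (fun k => gap k * G (radial zeta k))%C kappa ->
  unit_disk z ->
  kappa * (1 - Cmod z ^ 2) <= 2 * Re (G z) * Cmod (z - zeta) ^ 2.
Proof.
intros HG Hp Hzeta Hk Hlim Hz.
set (K := fun k => (gap k * G (radial zeta k))%C) in *.
assert (Hineq : forall k,
  Cmod (gap k * G z + Cconj (K k)) ^ 2 * ((1 - Cmod z ^ 2) * (2 - gap k))
  <= 4 * Re (G z) * Re (K k) * Cmod (1 - Cconj (radial zeta k) * z) ^ 2).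
{ intros k. pose proof (gap_bounds k) as Hg.
  pose proof (schwarz_pick_half_plane G z (radial zeta k) HG Hp Hz (unit_disk_radial _ k Hzeta)) as H.
  rewrite Cmod_radial in H by auto.
  replace (gap k * G z + Cconj (K k))%C with (gap k * (G z + Cconj (G (radial zeta k))))%C.
  2:{ unfold K. rewrite Cmult_conj, Cconj_R. ring. }
  replace (Re (K k)) with (gap k * Re (G (radial zeta k))) by (unfold K, Re; simpl; ring).
  rewrite Cmod_mult, Cmod_R, Rabs_pos_eq by lra.
  replace (1 - (1 - gap k) ^ 2) with (gap k * (2 - gap k)) in H by ring.
  nra. }
destruct Hlim as [HK1 HK2].
assert (HL : is_lim_seq (fun k => Cmod (gap k * G z + Cconj (K k)) ^ 2 * ((1 - Cmod z ^ 2) * (2 - gap k)))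
   (Cmod (RtoC 0 * G z + Cconj kappa) ^ 2 * ((1 - Cmod z ^ 2) * (2 - 0)))).
{ apply is_lim_seq_mult'. apply is_lim_seq_Cmod_sqr. apply is_Clim_seq_plus.
  apply is_Clim_seq_mult. apply is_Clim_seq_RtoC, is_lim_seq_gap. apply is_Clim_seq_const.
  apply is_Clim_seq_conj. split; auto.
  apply is_lim_seq_mult'. apply is_lim_seq_const. apply is_lim_seq_minus'. apply is_lim_seq_const. apply is_lim_seq_gap. }
assert (HR : is_lim_seq (fun k => 4 * Re (G z) * Re (K k) * Cmod (1 - Cconj (radial zeta k) * z) ^ 2)
  (4 * Re (G z) * kappa * Cmod (1 - Cconj zeta * z) ^ 2)).
{ apply is_lim_seq_mult'. apply is_lim_seq_mult'. apply is_lim_seq_const. exact HK1.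
  apply is_lim_seq_Cmod_sqr. apply is_Clim_seq_minus. apply is_Clim_seq_const.
  apply is_Clim_seq_mult. apply is_Clim_seq_conj, is_Clim_seq_radial. apply is_Clim_seq_const. }
pose proof (is_lim_seq_le _ _ _ _ Hineq HL HR) as H. simpl in H.
replace (RtoC 0 * G z + Cconj kappa)%C with (RtoC kappa) in H.
2:{ rewrite Cconj_R. ring. }
rewrite Cmod_R, Rabs_pos_eq in H by lra.
replace (Cmod (1 - Cconj zeta * z)) with (Cmod (z - zeta)) in H.
2:{ replace (1 - Cconj zeta * z)%C with (- (Cconj zeta * (z - zeta)))%C.
    rewrite Cmod_opp, Cmod_mult, Cmod_conj, Hzeta. ring.
    replace (- (Cconj zeta * (z - zeta)))%C with (zeta * Cconj zeta - Cconj zeta * z)%C by ring.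
    rewrite <- Cmod2_conj, Hzeta. f_equal. rewrite RtoC_pow. ring. }
apply Rmult_le_reg_l with (2 * kappa). lra. simpl. lra.
Qed.

(** Now [G] is small at the boundary point: [1 - |w|^2] on the left and [Re (G w)] on the right each
    carry a factor [gap k], and dividing it out leaves finite limits. [Delta] is a limit of
    nonnegative real parts, which settles its sign. *)
Theorem julia_zero (G : C -> C) (Delta : R) (z : C) :
  holomorphic_on_disk G -> (forall u, unit_disk u -> 0 <= Re (G u)) ->
  is_Clim_seq (fun k => G (radial 1 k) / gap k)%C Delta ->
  unit_disk z ->
  0 <= Delta /\
  Cmod (G z) ^ 2 * (1 - Cmod z ^ 2) <= 2 * Delta * Re (G z) * Cmod (1 - z) ^ 2.
Proof.
intros HG Hp Hlim Hz.
set (K := fun k => (G (radial 1 k) / gap k)%C) in *.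
assert (Hg0 : forall k, RtoC (gap k) <> 0) by (intros k E; apply RtoC_inj in E; pose proof (gap_bounds k); lra).
assert (EG : forall k, G (radial 1 k) = (gap k * K k)%C) by (intros k; unfold K; field; auto).
assert (ER : forall k, Re (G (radial 1 k)) = gap k * Re (K k)) by (intros k; rewrite EG; unfold Re; simpl; ring).
assert (H1 : Cmod 1 = 1) by apply Cmod_1.
assert (Hineq : forall k,
  Cmod (G z + gap k * Cconj (K k)) ^ 2 * ((1 - Cmod z ^ 2) * (2 - gap k))
  <= 4 * Re (G z) * Re (K k) * Cmod (1 - Cconj (radial 1 k) * z) ^ 2).
{ intros k. pose proof (gap_bounds k) as Hg.
  pose proof (schwarz_pick_half_plane G z (radial 1 k) HG Hp Hz (unit_disk_radial _ k H1)) as H.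
  rewrite Cmod_radial, ER in H by auto.
  replace (Cconj (G (radial 1 k))) with (gap k * Cconj (K k))%C in H.
  2:{ now rewrite EG, Cmult_conj, Cconj_R. }
  replace (1 - (1 - gap k) ^ 2) with (gap k * (2 - gap k)) in H by ring.
  apply Rmult_le_reg_l with (gap k); lra. }
destruct Hlim as [HK1 HK2].
assert (HL : is_lim_seq (fun k => Cmod (G z + gap k * Cconj (K k)) ^ 2 * ((1 - Cmod z ^ 2) * (2 - gap k)))
   (Cmod (G z + RtoC 0 * Cconj Delta) ^ 2 * ((1 - Cmod z ^ 2) * (2 - 0)))).
{ apply is_lim_seq_mult'. apply is_lim_seq_Cmod_sqr. apply is_Clim_seq_plus. apply is_Clim_seq_const.
  apply is_Clim_seq_mult. apply is_Clim_seq_RtoC, is_lim_seq_gap.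
  apply is_Clim_seq_conj. split; auto.
  apply is_lim_seq_mult'. apply is_lim_seq_const. apply is_lim_seq_minus'. apply is_lim_seq_const. apply is_lim_seq_gap. }
assert (HR : is_lim_seq (fun k => 4 * Re (G z) * Re (K k) * Cmod (1 - Cconj (radial 1 k) * z) ^ 2)
  (4 * Re (G z) * Delta * Cmod (1 - Cconj 1 * z) ^ 2)).
{ apply is_lim_seq_mult'. apply is_lim_seq_mult'. apply is_lim_seq_const. exact HK1.
  apply is_lim_seq_Cmod_sqr. apply is_Clim_seq_minus. apply is_Clim_seq_const.
  apply is_Clim_seq_mult. apply is_Clim_seq_conj, is_Clim_seq_radial. apply is_Clim_seq_const. }
pose proof (is_lim_seq_le _ _ _ _ Hineq HL HR) as H. simpl in H.
split.
- refine (is_lim_seq_le (fun _ => 0) _ 0 Delta _ (is_lim_seq_const 0) HK1).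
  intros k. pose proof (Hp _ (unit_disk_radial 1 k H1)) as P. rewrite ER in P. pose proof (gap_bounds k). nra.
- replace (G z + RtoC 0 * Cconj Delta)%C with (G z) in H by ring.
  replace (1 - Cconj 1 * z)%C with (1 - z)%C in H by (rewrite Cconj_R; ring).
  simpl. lra.
Qed.

(** * Generators with boundary Denjoy-Wolff point *)

(** Along an orbit [w k] of [F t] that tends to [1], the defects [1 - |w k|^2] tend
    to [0], so they cannot increase from some index on; the two-point inequality at
    [z] and [w k] then passes to the limit as Wolff's horodisk inequality. *)
Theorem horodisk_contraction (F : R -> C -> C) (t : R) (z : C) :
  semigroup F -> is_denjoy_wolff_point F 1 -> 0 < t -> unit_disk z ->
  (1 - Cmod z ^ 2) * Cmod (1 - F t z) ^ 2 <= (1 - Cmod (F t z) ^ 2) * Cmod (1 - z) ^ 2.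
Proof.
intros (Hself & Hadd & _ & _) (_ & _ & _ & Hlim) Ht Hz.
set (w := fun k => F (INR k * t) 0).
assert (Hk : forall k, 0 <= INR k * t) by (intros k; apply Rmult_le_pos; [apply pos_INR | lra]).
assert (Hw : forall k, unit_disk (w k)) by (intros k; apply Hself; [apply Hk | apply unit_disk_0]).
assert (HwS : forall k, w (S k) = F t (w k)).
{ intros k. unfold w. rewrite S_INR. replace ((INR k + 1) * t) with (t + INR k * t) by ring.
  apply Hadd; auto. lra. apply unit_disk_0. }
assert (Lw : is_Clim_seq w 1).
{ apply is_Clim_seq_locally.
  apply (filterlim_comp _ _ _ (fun k => INR k * t) (fun s => F s 0) _ (Rbar_locally p_infty)).
  2: apply Hlim, unit_disk_0.
  apply (is_lim_seq_mult INR (fun _ => t) p_infty t p_infty).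
  apply is_lim_seq_INR. apply is_lim_seq_const.
  apply is_Rbar_mult_p_infty_pos. exact Ht. }
assert (LwS : is_Clim_seq (fun k => w (S k)) 1).
{ destruct Lw as [L1 L2]. split.
  - exact (proj1 (is_lim_seq_incr_1 (fun k => Re (w k)) _) L1).
  - exact (proj1 (is_lim_seq_incr_1 (fun k => Im (w k)) _) L2). }
assert (Hz' : unit_disk (F t z)) by (apply Hself; auto; lra).
set (A := fun k => (1 - Cmod z ^ 2) * Cmod (1 - Cconj (w (S k)) * F t z) ^ 2).
set (B := fun k => (1 - Cmod (F t z) ^ 2) * Cmod (1 - Cconj (w k) * z) ^ 2).
assert (LA : is_lim_seq A ((1 - Cmod z ^ 2) * Cmod (1 - F t z) ^ 2)).
{ replace (1 - F t z)%C with (1 - Cconj 1 * F t z)%C by (rewrite Cconj_R; ring).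
  apply is_lim_seq_mult'. apply is_lim_seq_const. apply is_lim_seq_Cmod_sqr.
  apply is_Clim_seq_minus. apply is_Clim_seq_const. apply is_Clim_seq_mult.
  now apply is_Clim_seq_conj. apply is_Clim_seq_const. }
assert (LB : is_lim_seq B ((1 - Cmod (F t z) ^ 2) * Cmod (1 - z) ^ 2)).
{ replace (1 - z)%C with (1 - Cconj 1 * z)%C by (rewrite Cconj_R; ring).
  apply is_lim_seq_mult'. apply is_lim_seq_const. apply is_lim_seq_Cmod_sqr.
  apply is_Clim_seq_minus. apply is_Clim_seq_const. apply is_Clim_seq_mult.
  now apply is_Clim_seq_conj. apply is_Clim_seq_const. }
set (d := fun k => 1 - Cmod (w k) ^ 2).
assert (Hd : forall k, 0 < d k) by (intros k; pose proof (proj1 (unit_disk_sqr _) (Hw k)); unfold d; lra).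
assert (Ld : is_lim_seq d 0).
{ replace 0 with (1 - Cmod 1 ^ 2) by (rewrite Cmod_1; ring).
  apply is_lim_seq_minus'. apply is_lim_seq_const. now apply is_lim_seq_Cmod_sqr. }
assert (SP : forall k, A k * d k <= B k * d (S k)).
{ intros k. pose proof (schwarz_pick (F t) z (w k) (Hself t ltac:(lra)) Hz (Hw k)) as H.
  rewrite <- HwS in H. unfold A, B, d. lra. }
apply Rnot_lt_le. intros Hlt.
assert (LAB : is_lim_seq (fun k => A k - B k)
   ((1 - Cmod z ^ 2) * Cmod (1 - F t z) ^ 2 - (1 - Cmod (F t z) ^ 2) * Cmod (1 - z) ^ 2))
  by now apply is_lim_seq_minus'.
apply is_lim_seq_spec in LAB.
destruct (LAB (mkposreal _ (proj2 (Rlt_0_minus _ _) Hlt))) as [n Hn]. simpl in Hn.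
assert (HAB : forall k, (n <= k)%nat -> B k < A k).
{ intros k Lk. specialize (Hn k Lk). apply Rabs_def2 in Hn. lra. }
assert (HB : forall k, 0 <= B k).
{ intros k. unfold B. apply unit_disk_sqr in Hz'. apply Rmult_le_pos. lra. apply pow2_ge_0. }
assert (Inc : forall k, (n <= k)%nat -> d n <= d k).
{ intros k Lk. induction Lk as [|k Lk IH]. lra.
  apply Rle_trans with (1 := IH). specialize (HAB k Lk). specialize (SP k). specialize (HB k).
  pose proof (Hd (S k)). nra. }
assert (d n <= 0).
{ refine (is_lim_seq_le_loc (fun _ => d n) d (d n) 0 _ (is_lim_seq_const _) Ld).
  exists n. exact Inc. }
specialize (Hd n). lra.
Qed.

(** The Berkson-Porta condition, obtained from the horodisk inequality at small times. It avoids
    dividing by [f z], whose nonvanishing is deduced from it. *)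
Lemma generator_half_plane (F : R -> C -> C) (f : C -> C) (z : C) :
  semigroup F -> is_denjoy_wolff_point F 1 -> is_generator F f -> unit_disk z ->
  Re (Cconj (1 - z) * Cconj (1 - z) * f z) <= 0.
Proof.
intros HF HD [_ Hf] Hz.
set (u := fun k => (RtoC (/ gap k) * (z - F (gap k) z))%C).
assert (Lu : is_Clim_seq u (f z)).
{ apply is_Clim_seq_locally.
  apply (filterlim_comp _ _ _ gap (fun t => (RtoC (/ t) * (z - F t z))%C) _ (at_right 0)).
  2: now apply Hf.
  intros P HP. pose proof (is_lim_seq_gap _ HP) as H. unfold filtermap in *.
  revert H. apply filter_imp. intros k H. apply H. apply gap_bounds. }
destruct (is_Clim_seq_mult _ _ _ _ (is_Clim_seq_const (Cconj (1 - z) * Cconj (1 - z))%C) Lu) as [L _].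
refine (is_lim_seq_le _ (fun _ => 0) _ 0 _ L (is_lim_seq_const 0)).
intros k. pose proof (gap_bounds k) as Hg.
pose proof (horodisk_contraction F (gap k) z HF HD ltac:(lra) Hz) as H.
assert (E : F (gap k) z = (z - gap k * u k)%C).
{ unfold u. rewrite RtoC_inv by lra. field. intros E; apply RtoC_inj in E; lra. }
rewrite E in H.
apply unit_disk_sqr in Hz. revert H Hz. generalize (gap k) (u k) Hg. clear. intros t g Ht.
rewrite !Cmod_sqr. destruct z as [x y], g as [p q]. unfold Re; simpl. intros H Hz.
(* Up to a factor [t] this is the second-order term of the horodisk inequality. Its sign makes the
   claim exact for every difference quotient, with no remainder to estimate. *)
assert (P : 0 <= t * (p ^ 2 + q ^ 2) * (1 - (x * x + y * y) + (1 - x) ^ 2 + y ^ 2)).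
{ apply Rmult_le_pos. apply Rmult_le_pos; nra. nra. }
apply Rmult_le_reg_l with (2 * t). lra.
nra.
Qed.

Lemma Re_Cdiv (a b : C) : b <> 0 -> Re (a / b) = Re (a * Cconj b) / Cmod b ^ 2.
Proof.
intros Hb. apply Cmod_gt_0, (pow_lt _ 2) in Hb. rewrite Cmod_sqr in *.
destruct a as [a1 a2], b as [b1 b2]. unfold Re, Cdiv, Cmult, Cinv, Cconj; simpl in *. field. lra.
Qed.

Lemma unit_disk_neq (z zeta : C) : unit_disk z -> Cmod zeta = 1 -> (z - zeta)%C <> 0.
Proof.
intros Hz Hzeta E. assert (z = zeta) as -> by (replace z with (z - zeta + zeta)%C by ring; rewrite E; ring).
unfold unit_disk in Hz. lra.
Qed.

Lemma unit_disk_neq_1 (z : C) : unit_disk z -> (1 - z)%C <> 0.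
Proof.
intros Hz E. apply (unit_disk_neq z 1 Hz Cmod_1).
replace (z - 1)%C with (- (1 - z))%C by ring. rewrite E. ring.
Qed.

(** At a zero of [f] the two-point inequality for [P] has right side [0], which forces [P] and [f]
    to vanish on the whole disk, against [m <> 0]. *)
Lemma generator_nonzero (F : R -> C -> C) (f : C -> C) (m : R) (z : C) :
  semigroup F -> is_denjoy_wolff_point F 1 -> is_generator F f ->
  is_angular_derivative f 1 m -> m <> 0 -> unit_disk z -> f z <> 0.
Proof.
intros HF HD Hf [_ Hm] Hm0 Hz Hfz.
set (P := fun u => (- f u / ((1 - u) * (1 - u)))%C).
assert (N : forall u, unit_disk u -> ((1 - u) * (1 - u))%C <> 0)
  by (intros u Hu; apply Cmult_neq_0; now apply unit_disk_neq_1).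
assert (HP : holomorphic_on_disk P).
{ intros u Hu. apply ex_Cderive_div; auto.
  - apply ex_Cderive_opp. now apply Hf.
  - apply ex_Cderive_mult; apply ex_Cderive_const_minus. }
assert (RP : forall u, unit_disk u -> 0 <= Re (P u)).
{ intros u Hu. unfold P. rewrite Re_Cdiv by auto. apply Rdiv_le_0_compat.
  2: apply pow_lt, Cmod_gt_0; auto.
  replace (- f u * Cconj ((1 - u) * (1 - u)))%C with (- (Cconj (1 - u) * Cconj (1 - u) * f u))%C
    by (rewrite Cmult_conj; ring).
  pose proof (generator_half_plane F f u HF HD Hf Hu). unfold Re in *; simpl in *. lra. }
assert (PZ : P z = 0) by (unfold P; rewrite Hfz; field; now apply unit_disk_neq_1).
assert (f0 : forall u, unit_disk u -> f u = 0).
{ intros u Hu. pose proof (schwarz_pick_half_plane P u z HP RP Hu Hz) as H.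
  rewrite PZ in H. replace (P u + Cconj 0)%C with (P u) in H by (rewrite Cconj_R; ring).
  replace (Re 0) with 0 in H by reflexivity.
  assert (P u = 0) as E.
  { apply Cmod_eq_0. pose proof (proj1 (unit_disk_sqr u) Hu). pose proof (proj1 (unit_disk_sqr z) Hz).
    assert (0 < (1 - Cmod u ^ 2) * (1 - Cmod z ^ 2)) by (apply Rmult_lt_0_compat; lra).
    apply Rle_antisym. 2: apply Cmod_ge_0. apply Rnot_lt_le. intros Hlt.
    apply (pow_lt _ 2) in Hlt.
    assert (0 < Cmod (P u) ^ 2 * ((1 - Cmod u ^ 2) * (1 - Cmod z ^ 2))) by now apply Rmult_lt_0_compat.
    lra. }
  replace (f u) with (- P u * ((1 - u) * (1 - u)))%C by (unfold P; field; now apply unit_disk_neq_1).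
  rewrite E. ring. }
apply Hm0. apply RtoC_inj. symmetry.
apply is_Clim_seq_unique with (1 := is_Clim_seq_ext _ _ _ (fun k => eq_refl) (is_Clim_seq_const 0)).
apply (is_Clim_seq_ext _ (fun _ => RtoC 0)) with (2 := angular_limit_radial _ 1 m Cmod_1 Hm).
intros k. rewrite f0 by (apply unit_disk_radial, Cmod_1). unfold Cdiv. ring.
Qed.

(** Up to an imaginary constant, which makes it vanish at [z = 1], this is [|1 - zeta|^2 / 2] times
    the Herglotz kernel [(zeta + z) / (zeta - z)]. *)
Lemma Re_point_mass (zeta z : C) : Cmod zeta = 1 -> unit_disk z ->
  Re ((1 - zeta) * (1 - z) / (z - zeta)) =
  Cmod (1 - zeta) ^ 2 * (1 - Cmod z ^ 2) / (2 * Cmod (z - zeta) ^ 2).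
Proof.
intros Hzeta Hz. pose proof (unit_disk_neq z zeta Hz Hzeta) as N.
rewrite Re_Cdiv by auto. apply Cmod_gt_0 in N.
assert (H1 : Cmod zeta ^ 2 = 1) by (rewrite Hzeta; ring).
replace (Re ((1 - zeta) * (1 - z) * Cconj (z - zeta)))
  with (Cmod (1 - zeta) ^ 2 * (1 - Cmod z ^ 2) / 2).
{ field. lra. }
rewrite Cmod_sqr in H1. rewrite !Cmod_sqr. destruct zeta as [a b], z as [x y]. unfold Re; simpl in *.
(* The two sides differ by a multiple of [1 - |zeta|^2], which is zero. *)
match goal with |- ?l = ?r =>
  replace r with (l + (1 - (a * (a * 1) + b * (b * 1))) * (2 * x - 1 - (x * x + y * y)) / 2) by field end.
rewrite H1. field.
Qed.

(** * Removal of the point masses and the disk estimate *)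

Theorem theorem6p2 (F : R -> C -> C) (f : C -> C) (m : R)
    (N : nat) (zeta : nat -> C) (mu : nat -> R)
    (hF : hyperbolic_semigroup F)
    (hf : is_generator F f)
    (hDW : is_denjoy_wolff_point F 1%R)
    (hfm : is_angular_derivative f 1%R m)
    (hm : 0 < m)
    (hdistinct : forall i j : nat, (1 <= i <= N)%nat -> (1 <= j <= N)%nat ->
       i <> j -> zeta i <> zeta j)
    (hzeta1 : forall n : nat, (1 <= n <= N)%nat -> zeta n <> 1%R)
    (hnull : forall n : nat, (1 <= n <= N)%nat ->
       boundary_regular_null_point f (zeta n))
    (hmu : forall n : nat, (1 <= n <= N)%nat ->
       is_angular_derivative f (zeta n) (mu n) /\ mu n < 0) :
  let Delta : R := / m - sum_n_m (fun n : nat => / Rabs (mu n)) 1 N in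
  forall z : C, unit_disk z ->
    Cmod (/ f z
          - sum_n_m (fun n : nat =>
              RtoC (/ Rabs (mu n)) * (/ (z - 1%R) - / (z - zeta n))) 1 N
          + RtoC (Delta / (1 - Cmod z ^ 2)) * ((1%R - Cconj z) / (1%R - z)))%C
    <= Delta / (1 - Cmod z ^ 2).
Proof.
intros Delta.
destruct hF as [HF _].
assert (f0 : forall u, unit_disk u -> f u <> 0) by (intros u Hu; eapply generator_nonzero; eauto; lra).
assert (Hz1 : forall n, (1 <= n <= N)%nat -> Cmod (zeta n) = 1) by (intros n Hn; now apply hnull).
assert (z10 : forall n, (1 <= n <= N)%nat -> (1 - zeta n)%C <> 0).
{ intros n Hn E. apply (hzeta1 n Hn). replace (zeta n) with (1 - (1 - zeta n))%C by ring. rewrite E. ring. }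
set (c := fun n => / Rabs (mu n)).
assert (Hc : forall n, (1 <= n <= N)%nat -> 0 < c n).
{ intros n Hn. destruct (hmu n Hn). apply Rinv_0_lt_compat, Rabs_pos_lt. lra. }
set (Sg := fun n z => sum_n_m (fun n => (RtoC (/ Rabs (mu n)) * (/ (z - 1) - / (z - zeta n)))%C) 1 n).
(* Multiplication by [- (1 - z)^2] turns the summand of index [n] into [c n * h n z], so [G n] is
   [q] without its first [n] masses. *)
set (G := fun n z => (- ((1 - z) * (1 - z)) * (/ f z - Sg n z))%C).
set (h := fun n z => ((1 - zeta n) * (1 - z) / (z - zeta n))%C).
assert (GS : forall n z, (1 <= S n <= N)%nat -> unit_disk z ->
   G (S n) z = (G n z - c (S n) * h (S n) z)%C).
{ intros n z Hn Hz. unfold G, Sg. rewrite sum_n_Sm by lia. fold (Sg n z).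
  change plus with Cplus. fold (c (S n)). unfold h.
  pose proof (unit_disk_neq z 1 Hz Cmod_1). pose proof (unit_disk_neq z _ Hz (Hz1 _ Hn)).
  field. repeat split; auto. }
(* The invariant keeps positivity, the masses still to be removed at their original values, and the
   current slope at [1]. *)
assert (I : forall n, (n <= N)%nat ->
  holomorphic_on_disk (G n) /\ (forall u, unit_disk u -> 0 <= Re (G n u)) /\
  (forall j, (n < j <= N)%nat ->
     is_Clim_seq (fun k => gap k * G n (radial (zeta j) k))%C (RtoC (Cmod (1 - zeta j) ^ 2 * c j))) /\
  is_Clim_seq (fun k => G n (radial 1 k) / gap k)%C (RtoC (/ m - sum_n_m c 1 n))).
{ induction n as [|n IH]; intros Hn.
  - assert (E0 : forall u, unit_disk u -> G 0%nat u = (- ((1 - u) * (1 - u)) / f u)%C).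
    { intros u Hu. unfold G, Sg. rewrite sum_n_m_zero by lia. change zero with (RtoC 0).
      field. auto. }
    assert (HS : forall u, Sg 0%nat u = RtoC 0) by (intros u; unfold Sg; now rewrite sum_n_m_zero by lia).
    split; [|split; [|split]].
    + intros u Hu. unfold G. apply ex_Cderive_mult.
      * apply ex_Cderive_opp, ex_Cderive_mult; apply ex_Cderive_const_minus.
      * apply ex_Cderive_minus.
        destruct (proj1 hf u Hu) as [l Hl]. eexists. apply is_Cderive_inv; eauto.
        apply (ex_derive_ext (K := C_AbsRing) (V := C_NormedModule) (fun _ => RtoC 0)).
        intros v; now rewrite HS. apply ex_Cderive_const.
    + intros u Hu. rewrite E0, Re_Cdiv by auto. apply Rdiv_le_0_compat.
      2: apply pow_lt, Cmod_gt_0; auto.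
      replace (Re (- ((1 - u) * (1 - u)) * Cconj (f u)))
        with (- Re (Cconj (1 - u) * Cconj (1 - u) * f u)).
      pose proof (generator_half_plane F f u HF hDW hf Hu). lra.
      destruct (f u), u. unfold Re; simpl. ring.
    + intros j Hj. destruct (hmu j ltac:(lia)) as [[_ Hmu] Hmu0].
      pose proof (Hz1 j ltac:(lia)) as Hzj.
      assert (Hzz : (zeta j * Cconj (zeta j))%C = 1) by (rewrite <- Cmod2_conj, Hzj; f_equal; ring).
      assert (Hmu1 : RtoC (mu j) <> 0) by (intros E; apply RtoC_inj in E; lra).
      (* On the circle [(1 - zeta)^2 * Cconj zeta = - |1 - zeta|^2], and [mu j < 0] makes the mass
         positive. *)
      replace (RtoC (Cmod (1 - zeta j) ^ 2 * c j))
        with ((1 - zeta j) * (1 - zeta j) * Cconj (zeta j) * / mu j)%C.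
      2:{ unfold c. rewrite Rabs_left by lra. rewrite RtoC_mult, RtoC_inv by lra.
          rewrite RtoC_opp, Cmod2_conj, Cminus_conj, Cconj_R.
          replace ((1 - zeta j) * (1 - zeta j) * Cconj (zeta j))%C
            with ((1 - zeta j) * (Cconj (zeta j) - zeta j * Cconj (zeta j)))%C by ring.
          rewrite Hzz. field. auto. }
      apply is_Clim_seq_ext with (fun k => (1 - radial (zeta j) k) * (1 - radial (zeta j) k) * Cconj (zeta j)
        * / (f (radial (zeta j) k) / (radial (zeta j) k - zeta j)))%C.
      * intros k. pose proof (unit_disk_radial (zeta j) k Hzj) as Hd.
        rewrite E0 by auto.
        (* As [Cconj (zeta j)] inverts [zeta j], this turns [gap k / f] into the reciprocal of the
           difference quotient, up to a constant factor. *)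
        assert (Eg : RtoC (gap k) = (- (radial (zeta j) k - zeta j) * Cconj (zeta j))%C).
        { unfold radial. rewrite RtoC_minus.
          replace (- ((1 - gap k) * zeta j - zeta j) * Cconj (zeta j))%C
            with (gap k * (zeta j * Cconj (zeta j)))%C by ring.
          rewrite Hzz. ring. }
        rewrite Eg. pose proof (unit_disk_neq _ _ Hd Hzj). field. split; auto.
      * apply is_Clim_seq_mult. apply is_Clim_seq_mult. 2: apply is_Clim_seq_const.
        apply is_Clim_seq_mult; (apply is_Clim_seq_minus; [apply is_Clim_seq_const | apply is_Clim_seq_radial]).
        apply is_Clim_seq_inv; auto. now apply (angular_limit_radial (fun u => f u / (u - zeta j))%C).
    + rewrite sum_n_m_zero by lia. change zero with 0. rewrite Rminus_0_r, RtoC_inv by lra.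
      apply is_Clim_seq_ext with (fun k => / (f (radial 1 k) / (radial 1 k - 1)))%C.
      * intros k. pose proof (unit_disk_radial 1 k Cmod_1) as Hd.
        rewrite E0 by auto. pose proof (unit_disk_neq _ _ Hd Cmod_1).
        assert (Hg0 : RtoC (gap k) <> 0) by (intros E; apply RtoC_inj in E; pose proof (gap_bounds k); lra).
        replace (1 - radial 1 k)%C with (RtoC (gap k)) by (unfold radial; rewrite RtoC_minus; ring).
        replace (radial 1 k - 1)%C with (- RtoC (gap k))%C by (unfold radial; rewrite RtoC_minus; ring).
        field. split; auto.
      * apply is_Clim_seq_inv. intros E; apply RtoC_inj in E; lra.
        apply (angular_limit_radial (fun u => f u / (u - 1))%C 1 m Cmod_1). apply hfm.
  - destruct IH as (IG & IR & IZ & I1); [lia|].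
    assert (Hn1 : (1 <= S n <= N)%nat) by lia.
    set (j := S n) in *.
    pose proof (Hz1 j Hn1) as Hzj. pose proof (Hc j Hn1) as Hcj.
    split; [|split; [|split]].
    + intros u Hu. pose proof (unit_disk_neq u _ Hu Hzj).
      (* [GS] holds only inside the disk, so differentiability is transferred on the ball of radius
         [1 - |u|]. *)
      apply (ex_derive_ext_loc (K := C_AbsRing) (V := C_NormedModule) (fun v => G n v - c j * h j v)%C).
      2:{ apply ex_Cderive_minus. now apply IG. apply ex_Cderive_mult. apply ex_Cderive_const.
          apply ex_Cderive_div; auto.
          apply ex_Cderive_mult. apply ex_Cderive_const.
          apply ex_Cderive_const_minus. apply ex_Cderive_minus_const. }
      assert (Hd : 0 < 1 - Cmod u) by (unfold unit_disk in Hu; lra).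
      exists (mkposreal _ Hd). intros v Hv. change C in v. change (Cmod (v - u) < 1 - Cmod u) in Hv. symmetry. apply GS; auto.
      unfold unit_disk. pose proof (Cmod_triangle (v - u) u) as T.
      replace (v - u + u)%C with v in T by ring. lra.
    + intros u Hu. unfold j. rewrite GS by auto. fold j.
      (* For this mass Julia's lower bound on [Re (G n u)] is exactly [c j * Re (h j u)]. *)
      assert (Hk : 0 < Cmod (1 - zeta j) ^ 2 * c j).
      { apply Rmult_lt_0_compat; auto. apply pow_lt, Cmod_gt_0; auto. }
      pose proof (julia_point_mass (G n) (zeta j) _ u IG IR Hzj Hk (IZ j ltac:(lia)) Hu) as J.
      replace (Re (G n u - c j * h j u)) with (Re (G n u) - c j * Re (h j u)) by (unfold Re; simpl; ring).
      unfold h. rewrite Re_point_mass by auto.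
      pose proof (proj1 (Cmod_gt_0 _) (unit_disk_neq u _ Hu Hzj)) as P.
      apply Rmult_le_reg_r with (2 * Cmod (u - zeta j) ^ 2). nra.
      match goal with |- _ <= ?r =>
        replace r with (2 * Re (G n u) * Cmod (u - zeta j) ^ 2 - Cmod (1 - zeta j) ^ 2 * c j * (1 - Cmod u ^ 2))
          by (field; lra) end.
      lra.
    (* [h j] has a finite limit at [zeta i], so the factor [gap k] annihilates its contribution to
       the mass there. *)
    + intros i Hi. pose proof (Hz1 i ltac:(lia)) as Hzi.
      assert (Hij : (zeta i - zeta j)%C <> 0).
      { intros E. apply (hdistinct i j); try lia.
        replace (zeta i) with (zeta i - zeta j + zeta j)%C by ring. rewrite E; ring. }
      replace (RtoC (Cmod (1 - zeta i) ^ 2 * c i)) with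
        (RtoC (Cmod (1 - zeta i) ^ 2 * c i) - 0 * (c j * ((1 - zeta j) * (1 - zeta i) * / (zeta i - zeta j))))%C by ring.
      apply is_Clim_seq_ext with (fun k => gap k * G n (radial (zeta i) k) -
         gap k * (c j * ((1 - zeta j) * (1 - radial (zeta i) k) * / (radial (zeta i) k - zeta j))))%C.
      * intros k. unfold j. rewrite GS by (auto; now apply unit_disk_radial). fold j.
        unfold h, Cdiv. ring.
      * apply is_Clim_seq_minus. apply IZ; lia.
        apply is_Clim_seq_mult. apply is_Clim_seq_RtoC, is_lim_seq_gap.
        apply is_Clim_seq_mult. apply is_Clim_seq_const.
        apply is_Clim_seq_mult. apply is_Clim_seq_mult. apply is_Clim_seq_const.
        apply is_Clim_seq_minus. apply is_Clim_seq_const. apply is_Clim_seq_radial.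
        apply is_Clim_seq_inv; auto. apply is_Clim_seq_minus. apply is_Clim_seq_radial. apply is_Clim_seq_const.
    (* [h j / gap k] equals [(1 - zeta j) / (radial 1 k - zeta j)] along the radius to [1], with
       limit [1]. *)
    + unfold j. rewrite sum_n_Sm by lia. change plus with Rplus. fold j.
      replace (RtoC (/ m - (sum_n_m c 1 n + c j)))
        with (RtoC (/ m - sum_n_m c 1 n) - c j * ((1 - zeta j) * / (1 - zeta j)))%C.
      2:{ rewrite !RtoC_minus, RtoC_plus. field. auto. }
      apply is_Clim_seq_ext with (fun k => G n (radial 1 k) / gap k - c j * ((1 - zeta j) * / (radial 1 k - zeta j)))%C.
      * intros k. pose proof (unit_disk_radial 1 k Cmod_1) as Hd.
        unfold j. rewrite GS by auto. fold j. unfold h.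
        assert (Hg0 : RtoC (gap k) <> 0) by (intros E; apply RtoC_inj in E; pose proof (gap_bounds k); lra).
        pose proof (unit_disk_neq _ _ Hd Hzj).
        replace (1 - radial 1 k)%C with (RtoC (gap k)) by (unfold radial; rewrite RtoC_minus; ring).
        field. split; auto.
      * apply is_Clim_seq_minus; auto. apply is_Clim_seq_mult. apply is_Clim_seq_const.
        apply is_Clim_seq_mult. apply is_Clim_seq_const.
        apply is_Clim_seq_inv; auto. apply is_Clim_seq_minus. apply is_Clim_seq_radial. apply is_Clim_seq_const. }
intros z Hz. destruct (I N (le_n N)) as (HG & HR & _ & HL).
fold (c) in Delta.
destruct (julia_zero (G N) Delta z HG HR) as [HD HJ]; auto.
pose proof (proj1 (unit_disk_sqr z) Hz) as Hz2.
pose proof (unit_disk_neq_1 z Hz) as N1.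
assert (He : 0 < 1 - Cmod z ^ 2) by lra.
set (e := 1 - Cmod z ^ 2) in *.
(* [julia_zero] places [G N z] in the closed disk with centre and radius both equal to [delta]. *)
set (delta := Delta / e * Cmod (1 - z) ^ 2).
pose proof (proj1 (Cmod_gt_0 _) N1) as P1.
assert (Hdelta : 0 <= delta) by (apply Rmult_le_pos; [now apply Rdiv_le_0_compat | apply pow2_ge_0]).
change (Cmod (/ f z - Sg N z + RtoC (Delta / e) * ((1 - Cconj z) / (1 - z)))%C <= Delta / e).
(* Since [|1 - z|^2 / (1 - z)^2 = (1 - Cconj z) / (1 - z)], the last summand is
   [delta / (1 - z)^2]. *)
replace (/ f z - Sg N z + RtoC (Delta / e) * ((1 - Cconj z) / (1 - z)))%C
  with (- (G N z - RtoC delta) / ((1 - z) * (1 - z)))%C.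
2:{ unfold G, delta. rewrite RtoC_mult, Cmod2_conj, Cminus_conj, Cconj_R.
    field. split; auto. }
rewrite Cmod_div by now apply Cmult_neq_0. rewrite Cmod_opp, Cmod_mult.
apply Rmult_le_reg_r with (Cmod (1 - z) * Cmod (1 - z)). nra.
unfold Rdiv at 1. rewrite Rmult_assoc, Rinv_l by nra. rewrite Rmult_1_r.
replace (Delta / e * (Cmod (1 - z) * Cmod (1 - z))) with delta by (unfold delta; ring).
assert (HJ' : Cmod (G N z) ^ 2 <= 2 * delta * Re (G N z)).
{ apply Rmult_le_reg_r with e; auto. unfold delta.
  replace (2 * (Delta / e * Cmod (1 - z) ^ 2) * Re (G N z) * e)
    with (2 * Delta * Re (G N z) * Cmod (1 - z) ^ 2) by (field; lra). exact HJ. }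
assert (HX : Cmod (G N z - delta) ^ 2 = Cmod (G N z) ^ 2 - 2 * delta * Re (G N z) + delta ^ 2)
  by (rewrite !Cmod_sqr; unfold Re; destruct (G N z); simpl; ring).
apply Rnot_lt_le. intros Hlt. nra.
Qed.
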